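(* Let $\mathbb{K}$ be a field, $R=\mathbb{K}[x_1,\dots,x_n]$, and let $J(G)\subseteq R$ be the cover ideal of a simple connected graph $G$ on the vertex set $\{x_1,\dots,x_n\}$. Let $x_n$ be a vertex of degree one, and suppose that $G\setminus\{x_n\}$ has at least one edge. Then $\Lambda(R/J(G))=\Lambda(R/J(G\setminus\{x_n\}))$.
   Context: Cover ideal: for a finite simple graph $G$ with vertices among $x_1,\dots,x_n$ and edge set $E_G$, $J(G)=\bigcap_{\{x_i,x_j\}\in E_G}(x_i,x_j)\subseteq R$. $G\setminus\{x_n\}$ is the graph obtained by removing the vertex $x_n$ and the edges containing it; its cover ideal is regarded as an ideal of the same ring $R$. Lyubeznik numbers: for a squarefree monomial ideal $J\subseteq R$ with $\mathfrak m=(x_1,\dots,x_n)$, $\lambda_{p,i}(R/J):=\mu_p(\mathfrak m,H^{n-i}_J(R))$, the $p$-th Bass number of $H_J^{n-i}(R)$ with respect to $\mathfrak m$. They vanish unless $0\le p\le i\le d=\dim R/J$. The Lyubeznik table is $\Lambda(R/J)=(\lambda_{p,i}(R/J))_{0\le p\le i\le d}$. *)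

(* Defs.v *)
From HB Require Import structures.
From mathcomp Require Import all_boot all_order all_algebra ring_quotient.
From mathcomp Require Import mpoly.
From mathcomp Require Import boolp classical_sets functions.

Set Implicit Arguments.
Unset Strict Implicit.
Unset Printing Implicit Defensive.

Import GRing.Theory.
Local Open Scope ring_scope.
Local Open Scope quotient_scope.

Section Submodule.
Variables (R : comNzRingType) (M : lmodType R) (S : submodClosed M).

Record submodule := Submodule { submodule_val : M; _ : submodule_val \in S }.

HB.instance Definition _ := [isSub for submodule_val].
HB.instance Definition _ := [Choice of submodule by <:].
HB.instance Definition _ := GRing.SubChoice_isSubLmodule.Build R M _ submodule
  (GRing.subsemimodClosedP S).

End Submodule.

Section SubmoduleMap.
Variables (R : comNzRingType) (M N : lmodType R).
Variables (S : submodClosed M) (T : submodClosed N) (f : {linear M -> N}).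
Hypothesis fST : forall x, x \in S -> f x \in T.

Definition submodule_map (x : submodule S) : submodule T :=
  Submodule (fST (valP x)).

Let submodule_map_linear : linear submodule_map.
Proof. by move=> a x y; apply: val_inj; rewrite /= linearP. Qed.

HB.instance Definition _ := GRing.isLinear.Build R _ _ _ submodule_map
  submodule_map_linear.

End SubmoduleMap.

Section QuotientModule.
Variables (R : comNzRingType) (M : lmodType R) (S : submodClosed M).

(* submodClosed structures do not record closure under opposite, which the
   quotient type requires, so S is first turned into a zmodClosed. *)
Definition submod_pred : {pred M} := fun x => x \in S.

HB.instance Definition _ := GRing.isSubmodClosed.Build R M submod_pred
  (GRing.subsemimodClosedP S).

Definition submod_zmod : zmodClosed M :=
  HB.pack_for (zmodClosed M) submod_pred.

Local Notation Q := (Quotient.quot submod_zmod).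

Definition quotient_scale (a : R) (x : Q) : Q := \pi_Q (a *: repr x).
Local Notation scale := quotient_scale.

Let pi_scale (a : R) (x : M) : \pi_Q (a *: x) = scale a (\pi_Q x).
Proof.
apply/eqP; rewrite -Quotient.idealrBE -scalerBr.
by apply: rpredZ; rewrite Quotient.idealrBE reprK.
Qed.

Let scaleA a b (x : Q) : scale a (scale b x) = scale (a * b) x.
Proof. by rewrite [scale b x]/scale -pi_scale scalerA. Qed.

Let scale1 : left_id 1 scale.
Proof. by move=> x; rewrite /scale scale1r reprK. Qed.

Let scaleDr : right_distributive scale +%R.
Proof.
move=> a x y.
have -> : x + y = \pi_Q (repr x + repr y) by rewrite raddfD /= !reprK.
by rewrite -pi_scale scalerDr raddfD.
Qed.

Let scaleDl (x : Q) : {morph scale^~ x : a b / a + b}.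
Proof. by move=> a b; rewrite /scale scalerDl raddfD. Qed.

HB.instance Definition _ := GRing.Zmodule_isLmodule.Build R Q
  scaleA scale1 scaleDr scaleDl.

Definition quotient_module : lmodType R := Q.

Definition quotient_proj (x : M) : quotient_module := \pi_Q x.

Let quotient_proj_linear : linear quotient_proj.
Proof. by move=> a x y; rewrite /quotient_proj raddfD /= pi_scale. Qed.

HB.instance Definition _ := GRing.isLinear.Build R M quotient_module _
  quotient_proj quotient_proj_linear.

End QuotientModule.

(* Ideals as submodules of the regular module; the unit ideal is allowed. *)
Notation ideal R := (submodClosed R^o).

Section Ideals.
Variable R : comNzRingType.

Section Generated.
Variable S : R -> Prop.

Definition ideal_gen : {pred R^o} := fun f =>
  `[< exists2 r : seq (R * R), (forall c, c \in r -> S c.2) &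
      f = \sum_(c <- r) c.1 * c.2 >].

Lemma ideal_gen_closed : submod_closed ideal_gen.
Proof.
split=> [|a f g /asboolP[r Sr ->] /asboolP[s Ss ->]].
  by apply/asboolP; exists [::]; rewrite ?big_nil.
apply/asboolP; exists ([seq (a * c.1, c.2) | c <- r] ++ s).
  move=> c; rewrite mem_cat => /orP[/mapP[d dr ->]|]; last exact: Ss.
  exact: (Sr d dr).
rewrite big_cat big_map; congr (_ + _).
rewrite /GRing.scale /= mulr_sumr; apply: eq_bigr => c _ /=.
by rewrite mulrA.
Qed.

HB.instance Definition _ := GRing.isSubmodClosed.Build R R^o ideal_gen
  ideal_gen_closed.

End Generated.

Lemma ideal_gen_sub (S T : R -> Prop) : (forall a, S a -> a \in ideal_gen T) ->
  {subset ideal_gen S <= ideal_gen T}.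
Proof.
move=> ST f /asboolP[r Sr ->].
have [T0 Tlin] := ideal_gen_closed T.
elim: r Sr => [|c r IHr] Sr; first by rewrite big_nil; exact: T0.
rewrite big_cons; apply: (Tlin c.1 c.2); first exact/ST/Sr/mem_head.
by apply: IHr => d dr; apply: Sr; rewrite in_cons dr orbT.
Qed.

Definition ideal_pow (J : ideal R) (k : nat) : {pred R^o} :=
  ideal_gen (fun f : R => exists2 t : k.-tuple R,
    (forall a, a \in t -> a \in J) & f = \prod_(a <- t) a).

HB.instance Definition _ J k := GRing.SubmodClosed.on (ideal_pow J k).

Lemma ideal_powD (J : ideal R) (k l : nat) :
  {subset ideal_pow J (k + l) <= ideal_pow J k}.
Proof.
apply: ideal_gen_sub => _ [t Jt ->]; apply/asboolP.
have kt : size (take k t) == k by rewrite size_takel // size_tuple leq_addr.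
exists [:: (\prod_(a <- drop k t) a, \prod_(a <- Tuple kt) a)].
  move=> c; rewrite mem_seq1 => /eqP-> /=; exists (Tuple kt) => // a.
  by move=> /mem_take; exact: Jt.
by rewrite big_seq1 mulrC -big_cat /= cat_take_drop.
Qed.

Definition has_prime_chain (J : ideal R) (d : nat) : Prop :=
  exists P : 'I_d.+1 -> prime_idealr R,
    (forall i, {subset J <= P i}) /\
    (forall i j : 'I_d.+1, (i < j)%N ->
       {subset P i <= P j} /\ ~ {subset P j <= P i}).

(* The Krull dimension of R/J, the primes of R/J being the primes of R that
   contain J; junk if R/J is zero or has infinite dimension. *)
Definition quotient_dim (J : ideal R) : nat :=
  xget 0%N [set d | has_prime_chain J d /\ ~ has_prime_chain J d.+1].

End Ideals.

Section Complexes.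
Variable R : comNzRingType.

(* Cochain complexes in degrees 0, 1, 2, ... *)
Record cochain_complex := CochainComplex {
  cobj :> nat -> lmodType R;
  codiff : forall i, {linear cobj i -> cobj i.+1};
  codiffK : forall i x, codiff i.+1 (codiff i x) = 0
}.

Section Cohomology.
Variables (C : cochain_complex) (i : nat).

Definition cocycle : {pred C i} := fun x => codiff C i x == 0.

Let cocycle_closed : submod_closed cocycle.
Proof.
split=> [|a x y /eqP dx /eqP dy]; first by rewrite unfold_in linear0.
by rewrite unfold_in linearP dx dy scaler0 addr0.
Qed.

HB.instance Definition _ := GRing.isSubmodClosed.Build R (C i) cocycle
  cocycle_closed.

Definition is_coboundary : C i -> Prop :=
  match i return C i -> Prop with
  | 0 => fun x => x = 0
  | j.+1 => fun x => exists y : C j, codiff C j y = x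
  end.

Definition coboundary : {pred submodule cocycle} :=
  fun x => `[< is_coboundary (val x) >].

Let coboundary_closed : submod_closed coboundary.
Proof.
have cb0 : is_coboundary 0.
  by rewrite /is_coboundary; case: (i) => // j; exists 0; rewrite linear0.
have cbP a x y :
    is_coboundary x -> is_coboundary y -> is_coboundary (a *: x + y).
  rewrite /is_coboundary; case: (i) x y => [|j] x y.
    by move=> -> ->; rewrite scaler0 addr0.
  by move=> [u <-] [v <-]; exists (a *: u + v); rewrite linearP.
split=> [|a x y /asboolP dx /asboolP dy]; apply/asboolP; first exact: cb0.
exact: cbP.
Qed.

HB.instance Definition _ := GRing.isSubmodClosed.Build R _ coboundary
  coboundary_closed.

Definition cohomology : lmodType R := quotient_module coboundary.

End Cohomology.

Record chain_complex := ChainComplex {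
  chobj :> nat -> lmodType R;
  chdiff : forall i, {linear chobj i.+1 -> chobj i};
  chdiffK : forall i x, chdiff i (chdiff i.+1 x) = 0
}.

Definition injective_module (E : lmodType R) : Prop :=
  forall (A B : lmodType R) (u : {linear A -> B}) (f : {linear A -> E}),
    injective u -> exists g : {linear B -> E}, forall a, g (u a) = f a.

Definition projective_module (P : lmodType R) : Prop :=
  forall (A B : lmodType R) (q : {linear A -> B}) (f : {linear P -> B}),
    (forall b, exists a, q a = b) ->
    exists g : {linear P -> A}, forall x, q (g x) = f x.

Record injective_resolution (M : lmodType R) := InjectiveResolution {
  ires :> cochain_complex;
  ires_aug : {linear M -> ires 0};
  ires_injective : forall i, injective_module (ires i);
  ires_aug_inj : injective ires_aug;
  ires_exact0 : forall x, codiff ires 0 x = 0 <-> exists m, ires_aug m = x;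
  ires_exact : forall i x,
    codiff ires i.+1 x = 0 <-> exists y, codiff ires i y = x
}.

Record projective_resolution (N : lmodType R) := ProjectiveResolution {
  pres :> chain_complex;
  pres_aug : {linear pres 0 -> N};
  pres_projective : forall i, projective_module (pres i);
  pres_aug_surj : forall y, exists x, pres_aug x = y;
  pres_exact0 : forall x, pres_aug x = 0 <-> exists y, chdiff pres 0 y = x;
  pres_exact : forall i x,
    chdiff pres i x = 0 <-> exists y, chdiff pres i.+1 y = x
}.

End Complexes.

Section LocalCohomology.
Variables (R : comNzRingType) (J : ideal R).

Section Torsion.
Variable M : lmodType R.

Definition torsion : {pred M} := fun x =>
  `[< exists k, forall a : R, a \in ideal_pow J k -> a *: x = 0 >].

Let torsion_closed : submod_closed torsion.
Proof.
split=> [|a x y /asboolP[k kx] /asboolP[l ly]]; apply/asboolP.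
  by exists 0%N => a _; rewrite scaler0.
exists (k + l)%N => b Jb; rewrite scalerDr scalerA mulrC -scalerA.
rewrite kx; last exact: ideal_powD Jb.
by rewrite ly ?scaler0 ?addr0 //; move: Jb; rewrite addnC; exact: ideal_powD.
Qed.

HB.instance Definition _ := GRing.isSubmodClosed.Build R M torsion
  torsion_closed.

End Torsion.

Arguments torsion M x : clear implicits.

Lemma torsion_morph (M N : lmodType R) (f : {linear M -> N}) (x : M) :
  x \in torsion M -> f x \in torsion N.
Proof.
move=> /asboolP[k kx]; apply/asboolP; exists k => a Ja.
by rewrite -linearZ kx // linear0.
Qed.

Section TorsionComplex.
Variable C : cochain_complex R.

Let obj i : lmodType R := submodule (torsion (C i)).
Let diff i : {linear obj i -> obj i.+1} :=
  submodule_map (torsion_morph (codiff C i)).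
Let diffK i (x : obj i) : diff i.+1 (diff i x) = 0.
Proof. by apply: val_inj; rewrite /= codiffK. Qed.

Definition torsion_complex : cochain_complex R := CochainComplex diffK.

End TorsionComplex.

(* H^j_J(M), computed from an injective resolution I of M. *)
Definition local_cohomology (M : lmodType R) (I : injective_resolution M)
  (j : nat) : lmodType R := cohomology (torsion_complex I) j.

End LocalCohomology.

Arguments torsion {R} J M.

Section Ext.
Variable R : comNzRingType.

Definition hom_pred (A M : lmodType R) : {pred A -> M} :=
  fun f => `[< linear f >].

Section HomModule.
Variables A M : lmodType R.

Let hom_closed : submod_closed (@hom_pred A M).
Proof.
split=> [|a f g /asboolP lf /asboolP lg]; apply/asboolP=> b x y.
  by rewrite /GRing.zero /= scaler0 addr0.
have fctE (h : A -> M) k z : (a *: h + k) z = a *: h z + k z by [].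
rewrite !fctE lf lg !scalerDr !scalerA mulrC addrACA.
by [].
Qed.

HB.instance Definition _ := GRing.isSubmodClosed.Build R (A -> M)
  (@hom_pred A M) hom_closed.

End HomModule.

Definition hom_module (A M : lmodType R) : lmodType R :=
  submodule (@hom_pred A M).

Section HomMap.
Variables (A B M : lmodType R) (u : {linear B -> A}).

Let precomp (f : A -> M) : B -> M := f \o u.
Let precomp_linear : linear precomp. Proof. by []. Qed.
HB.instance Definition _ := GRing.isLinear.Build R (A -> M) (B -> M) _ precomp
  precomp_linear.

Let precomp_hom (f : A -> M) :
  f \in @hom_pred A M -> precomp f \in @hom_pred B M.
Proof.
by move=> /asboolP lf; apply/asboolP => a x y; rewrite /precomp /= linearP lf.
Qed.

Definition hom_map : {linear hom_module A M -> hom_module B M} :=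
  submodule_map precomp_hom.

End HomMap.

Section HomComplex.
Variables (F : chain_complex R) (M : lmodType R).

Let obj i : lmodType R := hom_module (F i) M.
Let diff i : {linear obj i -> obj i.+1} := hom_map M (chdiff F i).
Let diffK i (f : obj i) : diff i.+1 (diff i f) = 0.
Proof.
apply: val_inj; apply/funext => x /=; rewrite chdiffK.
by have /asboolP/(_ (-1) 0 0) := valP f; rewrite scaler0 add0r scaleN1r addNr.
Qed.

Definition hom_complex : cochain_complex R := CochainComplex diffK.

End HomComplex.

(* Ext^p_R(N, M), computed from a projective resolution F of N. *)
Definition Ext (N : lmodType R) (F : projective_resolution N) (M : lmodType R)
  (p : nat) : lmodType R := cohomology (hom_complex F M) p.

End Ext.

Section Lyubeznik.
Variables (K : fieldType) (n : nat).
Local Notation R := {mpoly K[n]}.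

Definition has_vdim (V : lmodType R) (d : nat) : Prop :=
  exists e : 'I_d -> V, forall v : V,
    exists! c : {ffun 'I_d -> K}, v = \sum_i (c i)%:MP_[n] *: e i.

(* The dimension of V over K; None stands for an infinite dimension. *)
Definition vdim (V : lmodType R) : option nat :=
  xget None [set od | exists2 d, od = Some d & has_vdim V d].

Definition maximal_ideal : {pred R^o} :=
  ideal_gen (fun f : R => exists i : 'I_n, f = 'X_i).

HB.instance Definition _ := GRing.SubmodClosed.on maximal_ideal.

Definition residue_field : lmodType R := quotient_module maximal_ideal.

(* mu_p(m, M) = dim_K Ext^p_R(R/m, M): since m is maximal this equals
   dim Ext^p over R_m of (R_m/mR_m, M_m).  It does not depend on the chosen
   projective resolution. *)
Definition bass_number (M : lmodType R) (p : nat) : option nat :=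
  xget None [set mu | exists F : projective_resolution residue_field,
    mu = vdim (Ext F M p)].

(* lambda_{p,i}(R/J); it does not depend on the chosen injective resolution. *)
Definition lyubeznik_number (J : ideal R) (p i : nat) : option nat :=
  xget None [set mu | exists I : injective_resolution R^o,
    mu = bass_number (local_cohomology J I (n - i)) p].

(* The i-th entry is the sequence of the lambda_{p,i}(R/J), 0 <= p <= i, and
   i ranges from 0 to dim R/J. *)
Definition lyubeznik_table (J : ideal R) : seq (seq (option nat)) :=
  [seq [seq lyubeznik_number J p i | p <- iota 0 i.+1]
     | i <- iota 0 (quotient_dim J).+1].

End Lyubeznik.

(* Simple graphs with vertices among 0, ..., n-1. *)
Record sgraph (n : nat) := SGraph {
  vert : {set 'I_n};
  adj : rel 'I_n;
  adj_sym : ssrbool.symmetric adj;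
  adj_irr : irreflexive adj;
  adj_vert : forall i j, adj i j -> i \in vert
}.

Section Graphs.
Variable n : nat.

Definition degree (G : sgraph n) (v : 'I_n) : nat := #|[set u | adj G v u]|.

Definition sgraph_connected (G : sgraph n) : Prop :=
  {in vert G &, forall u v, connect (adj G) u v}.

Section RemoveVertex.
Variables (G : sgraph n) (v : 'I_n).

Let adj' : rel 'I_n := fun i j => [&& adj G i j, i != v & j != v].

Let adj'_sym : ssrbool.symmetric adj'.
Proof. by move=> i j; rewrite /adj' adj_sym [(i != v) && _]andbC. Qed.

Let adj'_irr : irreflexive adj'.
Proof. by move=> i; rewrite /adj' adj_irr. Qed.

Let adj'_vert i j : adj' i j -> i \in vert G :\ v.
Proof. by case/and3P=> /adj_vert Gi iv _; rewrite !inE iv. Qed.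

Definition remove_vertex : sgraph n := SGraph adj'_sym adj'_irr adj'_vert.

End RemoveVertex.

Variable K : fieldType.
Local Notation R := {mpoly K[n]}.

Definition edge_prime (i j : 'I_n) : {pred R^o} :=
  ideal_gen (fun f : R => f = 'X_i \/ f = 'X_j).

HB.instance Definition _ i j := GRing.SubmodClosed.on (edge_prime i j).

Definition cover_ideal (G : sgraph n) : {pred R^o} := fun f =>
  [forall i, forall j, adj G i j ==> (f \in edge_prime i j)].

Let cover_ideal_closed G : submod_closed (cover_ideal G).
Proof.
split=> [|a f g /'forall_forallP Jf /'forall_forallP Jg].
  apply/'forall_forallP=> i j; apply/implyP => _.
  by have [] := ideal_gen_closed (fun f : R => f = 'X_i \/ f = 'X_j).
apply/'forall_forallP=> i j; apply/implyP => Gij.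
have [_ lin] := ideal_gen_closed (fun f : R => f = 'X_i \/ f = 'X_j).
by apply: lin; [exact: implyP (Jf i j) Gij | exact: implyP (Jg i j) Gij].
Qed.

HB.instance Definition _ G := GRing.isSubmodClosed.Build R R^o (cover_ideal G)
  (cover_ideal_closed G).

End Graphs.

Arguments cover_ideal {n} K G.

(* Main.v *)
(* Let y be the neighbour of x = x_n, let z be another neighbour of y, and put
   J' = J(G \ x) and J = J(G) = J' /\ (x, y).  The inclusion J <= J' induces
   H^i_{J'}(R) -> H^i_J(R) for every i; this map is injective and z acts
   bijectively on its cokernel.  Multiplication by z is null-homotopic on a
   projective resolution of R/m, so Ext^p(R/m, -) kills the cokernel and the two
   local cohomology modules have the same Bass numbers.

   Injectivity: a class in the kernel is killed by a power of x, because
   x J' <= J, whereas x is a nonzerodivisor on H^i_{J'}(R).  Indeed J' is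
   extended from the subring R0 of polynomials free of x, the map
   p |-> (p - p(x := 0)) / x is an R0-linear left inverse of multiplication by
   x on R, and it lifts R0-linearly to any injective R-resolution of R.

   Cokernel: for E injective, z is surjective on the J-torsion of E, as
   p |-> (p - p(z := 0)) / z maps J^(k+1) into J^k; and a J-torsion element u
   with z u J'-torsion is J'-torsion, because J' <= (y, z) gives
   J'^2 <= J + (z).

   As for the dimensions, a chain of primes containing J but not J' contains
   (x, y), and exchanging x and z turns it into a chain containing (y, z),
   hence J'. *)
Require Import Defs.
From HB Require Import structures.
From mathcomp Require Import all_boot all_order all_algebra perm.
From mathcomp Require Import ring_quotient mpoly zify.
From mathcomp Require Import boolp classical_sets functions.

Set Implicit Arguments.
Unset Strict Implicit.
Unset Printing Implicit Defensive.

Import GRing.Theory.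
Local Open Scope ring_scope.
Local Open Scope quotient_scope.

(** * Lifting and extending linear maps *)

Section LinearMaps.
Variable R : comNzRingType.
Implicit Types A B E P : lmodType R.

Lemma linear_bundle A B (f : A -> B) :
  linear f -> exists g : {linear A -> B}, g =1 f.
Proof.
move=> lf; pose m := GRing.isLinear.Build R A B _ f lf.
by exists (HB.pack_for {linear A -> B} f m).
Qed.

Section Composition.
Variables (A B E : lmodType R) (g : {linear B -> E}) (f : {linear A -> B}).

Definition linear_comp (x : A) : E := g (f x).

Let linear_comp_linear : linear linear_comp.
Proof. by move=> c x y; rewrite /linear_comp !linearP. Qed.

HB.instance Definition _ := GRing.isLinear.Build R A E _ linear_comp
  linear_comp_linear.

Definition linear_zero (x : A) : E := 0.

Let linear_zero_linear : linear linear_zero.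
Proof. by move=> c x y; rewrite /linear_zero scaler0 addr0. Qed.

HB.instance Definition _ := GRing.isLinear.Build R A E _ linear_zero
  linear_zero_linear.

End Composition.

Section Range.
Variables (A B : lmodType R) (d : {linear A -> B}).

Definition range_pred : {pred B} := fun b => `[< exists a, d a = b >].

Lemma range_pred_closed : submod_closed range_pred.
Proof.
split=> [|c x y /asboolP[a <-] /asboolP[b <-]]; apply/asboolP.
  by exists 0; rewrite linear0.
by exists (c *: a + b); rewrite linearP.
Qed.

HB.instance Definition _ := GRing.isSubmodClosed.Build R B range_pred
  range_pred_closed.

Lemma mem_range_pred a : d a \in range_pred. Proof. by apply/asboolP; exists a. Qed.

End Range.

(** Corestricting [d] and [f] to the range of [d] turns [d] into a surjection, as the definition of
    projectivity demands. *)
Lemma projective_lift A B P (d : {linear A -> B}) (f : {linear P -> B}) :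
    projective_module P -> (forall p, exists a, d a = f p) ->
  exists g : {linear P -> A}, forall p, d (g p) = f p.
Proof.
move=> projP df.
have [|q qE] := @linear_bundle A (submodule (range_pred d))
    (fun a => Submodule (mem_range_pred d a)).
  by move=> c x y; apply: val_inj; rewrite /= linearP.
have fd p : f p \in range_pred d by apply/asboolP; exact: df.
have [|h hE] := @linear_bundle P (submodule (range_pred d))
    (fun p => Submodule (fd p)).
  by move=> c x y; apply: val_inj; rewrite /= linearP.
have [|g gE] := projP _ _ q h.
  by move=> b; have /asboolP[a ab] := valP b; exists a; rewrite qE; apply: val_inj.
by exists g => p; have /(congr1 val) := gE p; rewrite qE hE.
Qed.

(** The map [d a |-> f a] is well defined on the range of [d] by the condition on kernels, and
    injectivity extends it along the inclusion into [B]. *)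
Lemma injective_extend A B E (d : {linear A -> B}) (f : {linear A -> E}) :
    injective_module E -> (forall a, d a = 0 -> f a = 0) ->
  exists g : {linear B -> E}, forall a, g (d a) = f a.
Proof.
move=> injE df.
have df_eq a b : d a = d b -> f a = f b.
  by move=> dab; apply/eqP; rewrite -subr_eq0 -linearB df ?linearB ?dab ?subrr.
have lift (b : submodule (range_pred d)) : {a | d a = val b}.
  by apply: cid; apply/asboolP; exact: valP b.
have [|h hE] := @linear_bundle (submodule (range_pred d)) E
    (fun b => f (sval (lift b))).
  move=> c x y; rewrite -linearP; apply: df_eq.
  by rewrite linearP !(svalP (lift _)).
have [|v vE] := @linear_bundle (submodule (range_pred d)) B val.
  by [].
have [|g gE] := injE _ _ v h.
  by move=> x y; rewrite !vE => /val_inj.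
exists g => a; have := gE (Submodule (mem_range_pred d a)).
rewrite vE /= => ->; rewrite hE; apply: df_eq.
by rewrite (svalP (lift _)).
Qed.

End LinearMaps.

(** * Maps between quotient modules *)

Section Quotients.
Variable R : comNzRingType.

Lemma quotient_proj_eq0 (M : lmodType R) (S : submodClosed M) (x : M) :
  quotient_proj S x = 0 <-> x \in S.
Proof.
have -> : (x \in S) = (quotient_proj S x == quotient_proj S 0).
  by rewrite -[x in LHS]subr0; exact: Quotient.idealrBE (submod_zmod S) x 0.
by rewrite linear0; split=> /eqP.
Qed.

Lemma quotient_proj_surj (M : lmodType R) (S : submodClosed M)
  (y : quotient_module S) : exists x, quotient_proj S x = y.
Proof. by exists (repr y); rewrite /quotient_proj reprK. Qed.

Lemma quotient_map (A B : lmodType R) (S : submodClosed A) (T : submodClosed B)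
    (g : {linear A -> B}) : (forall x, x \in S -> g x \in T) ->
  exists h : {linear quotient_module S -> quotient_module T},
    forall x, h (quotient_proj S x) = quotient_proj T (g x).
Proof.
move=> ST; pose h (y : quotient_module S) := quotient_proj T (g (repr y)).
have hE x : h (quotient_proj S x) = quotient_proj T (g x).
  apply/eqP; rewrite -subr_eq0 -!linearB /=; apply/eqP/quotient_proj_eq0/ST.
  by apply/quotient_proj_eq0; rewrite linearB /= /quotient_proj reprK subrr.
have [|h' h'E] := @linear_bundle R _ _ h; last by exists h' => x; rewrite h'E.
move=> c x y; have [u <-] := quotient_proj_surj x.
by have [v <-] := quotient_proj_surj y; rewrite -linearP !hE -linearP -linearP.
Qed.

Lemma quotient_iso (A B : lmodType R) (S : submodClosed A) (T : submodClosed B)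
    (g : {linear A -> B}) : (forall x, x \in S <-> g x \in T) ->
    (forall y, exists x, y - g x \in T) ->
  exists h : {linear quotient_module S -> quotient_module T}, bijective h.
Proof.
move=> gST gsurj; have [x /gST//|h hE] := @quotient_map _ _ S T g.
have inj_h : injective h.
  move=> x y hxy; apply/eqP; rewrite -subr_eq0.
  have [u uE] := quotient_proj_surj (x - y); rewrite -uE; apply/eqP.
  apply/quotient_proj_eq0/gST/quotient_proj_eq0; rewrite -hE uE linearB hxy.
  by rewrite subrr.
have surj_h y : {x | h x == y}.
  apply: cid; have [u <-] := quotient_proj_surj y; have [v uv] := gsurj u.
  exists (quotient_proj S v); rewrite hE eq_sym -subr_eq0 -linearB.
  exact/eqP/quotient_proj_eq0.
exists h, (fun y => sval (surj_h y)) => y.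
  by apply: inj_h; apply/eqP; exact: svalP (surj_h _).
by apply/eqP; exact: svalP (surj_h y).
Qed.

End Quotients.

Lemma vdim_bij (K : fieldType) (n : nat) (V W : lmodType {mpoly K[n]})
    (h : {linear V -> W}) : bijective h -> vdim V = vdim W.
Proof.
move=> [k hK kH].
suff hv d : has_vdim V d <-> has_vdim W d.
  congr xget; apply/funext => od; apply/propext.
  by split=> -[d -> /hv ?]; exists d.
split=> -[e eP].
  exists (h \o e) => w; have [c [cE cU]] := eP (k w); exists c; split.
    rewrite -[w]kH cE linear_sum; apply: eq_bigr => i _; exact: linearZ.
  move=> c' wE; apply: cU; rewrite wE -[RHS]hK; congr k.
  by rewrite linear_sum; apply: eq_bigr => i _; rewrite linearZ.
exists (k \o e) => v; have [c [cE cU]] := eP (h v); exists c; split.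
  rewrite -[v]hK cE -[RHS]hK; congr k; rewrite linear_sum; apply: eq_bigr => i _.
  by rewrite linearZ /= kH.
move=> c' vE; apply: cU; rewrite vE linear_sum; apply: eq_bigr => i _.
by rewrite linearZ /= kH.
Qed.

(** * Invariance of Ext *)

Section ExtInvariance.
Variable R : comNzRingType.

Definition to_hom (A M : lmodType R) (f : {linear A -> M}) : hom_module A M :=
  Submodule (S := @hom_pred R A M) (asboolT (linearP f)).

Lemma hom_linear (A M : lmodType R) (phi : hom_module A M) :
  exists f : {linear A -> M}, phi = to_hom f.
Proof.
have /asboolP/linear_bundle[f fE] := valP phi.
by exists f; apply: val_inj; apply/funext => x /=; rewrite fE.
Qed.

Lemma to_hom_inj (A M : lmodType R) (f g : {linear A -> M}) :
  to_hom f = to_hom g <-> f =1 g.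
Proof.
split=> [/(congr1 val) /= fg x|fg]; first by rewrite fg.
by apply: val_inj; exact/funext.
Qed.

Lemma to_hom_eq0 (A M : lmodType R) (f : {linear A -> M}) :
  to_hom f = 0 <-> forall x, f x = 0.
Proof.
split=> [/(congr1 val) /= f0 x|f0]; first by rewrite f0.
by apply: val_inj; exact/funext.
Qed.

Section HomCohomology.
Variables (F : chain_complex R) (M : lmodType R).

Lemma hom_cocycleP p (f : {linear F p -> M}) :
  to_hom f \in cocycle (C := hom_complex F M) (i := p)
  <-> forall x, f (chdiff F p x) = 0.
Proof.
rewrite unfold_in /cocycle; split=> [/eqP/(congr1 val) /= f0 x|f0].
  by have /= := congr1 (fun g => g x) f0.
by apply/eqP; apply: val_inj; apply/funext => x /=; exact: f0.
Qed.

(** Coboundaries of the Hom complex in terms of bundled linear maps, free of the subtype behind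
    [hom_module]. *)
Definition hom_coboundary p : {linear F p -> M} -> Prop :=
  match p with
  | 0 => fun f => forall x, f x = 0
  | q.+1 => fun f => exists g : {linear F q -> M}, forall x, f x = g (chdiff F q x)
  end.

Lemma hom_coboundaryP p (f : {linear F p -> M}) :
  is_coboundary (C := hom_complex F M) (i := p) (to_hom f) <-> hom_coboundary f.
Proof.
case: p f => [|p] f /=; first exact: to_hom_eq0.
split=> [[y yf]|[g gf]].
  have [g gE] := hom_linear y; exists g => x.
  by move/(congr1 val): yf; rewrite gE /= => <-.
exists (to_hom g); apply: val_inj; apply/funext => x /=; exact/esym/gf.
Qed.

End HomCohomology.

(** * Vanishing of Ext when an annihilator of [N] acts bijectively *)

Section Annihilated.
Variables (N : lmodType R) (F : projective_resolution N) (a : R).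
Hypothesis aN : forall y : N, a *: y = 0.

(** Multiplication by [a] vanishes after the augmentation, so by exactness it maps [F 0] into the
    range of the differential and lifts. *)
Lemma annihilator_homotopy0 :
  exists s : {linear F 0 -> F 1}, forall x, a *: x = chdiff F 0 (s x).
Proof.
have [|m mE] := @linear_bundle R (F 0%N) (F 0%N) (fun x => a *: x).
  by move=> c x y; rewrite scalerDr !scalerA mulrC.
have [|s sE] := projective_lift (d := chdiff F 0) (f := m)
    (@pres_projective _ _ F 0).
  by move=> x; apply/pres_exact0; rewrite mE linearZ /= aN.
by exists s => x; rewrite sE mE.
Qed.

(** The maps [s] and [t] are consecutive components of a null-homotopy of multiplication by [a];
    each [t] serves as the next [s]. *)
Lemma annihilator_homotopy p :
  exists (s : {linear F p -> F p.+1}) (t : {linear F p.+1 -> F p.+2}),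
    forall x, a *: x = chdiff F p.+1 (t x) + s (chdiff F p x).
Proof.
(* The assumption on [s] says that [a *: x - s (d x)] is a cycle, so exactness and projectivity give
   [t]. *)
have step q (s : {linear F q -> F q.+1}) :
    (forall x, chdiff F q (s (chdiff F q x)) = a *: chdiff F q x) ->
    exists t : {linear F q.+1 -> F q.+2},
    forall x, a *: x = chdiff F q.+1 (t x) + s (chdiff F q x).
  move=> sP.
  have [|m mE] := @linear_bundle R (F q.+1) (F q.+1)
      (fun x => a *: x - s (chdiff F q x)).
    move=> c x y; rewrite (linearP (chdiff F q)) (linearP s) scalerDr scalerBr.
    by rewrite !scalerA [a * c]mulrC opprD addrACA.
  have [|t tE] := projective_lift (d := chdiff F q.+1) (f := m)
    (@pres_projective _ _ F q.+1).
    by move=> x; apply/pres_exact; rewrite mE linearB /= linearZ /= sP subrr.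
  by exists t => x; rewrite tE mE subrK.
elim: p => [|p [s [t st]]].
  have [s sP] := annihilator_homotopy0; exists s.
  by apply: step => x; rewrite -sP.
exists t; apply: step => x; move: (st (chdiff F p.+1 x)).
by rewrite chdiffK linear0 addr0.
Qed.

(** Dividing [f] by [a] gives a cocycle [g] with [f x = g (a *: x)]. The homotopy rewrites [a *: x]
    as [d (t x) + s (d x)]; [g] kills the first term, and the composite of [g] with [s] bounds
    [f]. *)
Lemma hom_cohomology_eq0 (Q : lmodType R) p (f : {linear F p -> Q}) :
    (forall q : Q, exists! q', a *: q' = q) ->
    (forall x, f (chdiff F p x) = 0) ->
  hom_coboundary f.
Proof.
move=> aQ fd; have inj_a (q q' : Q) : a *: q = a *: q' -> q = q'.
  move=> eq_a; have [r [_ rU]] := aQ (a *: q).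
  by rewrite -(rU _ erefl) (rU q').
have div_a (q : Q) : {q' | a *: q' = q}.
  by apply: cid; have [q' [? _]] := aQ q; exists q'.
have [|g gE] := @linear_bundle R (F p) Q (fun x => sval (div_a (f x))).
  move=> c x y; apply: inj_a; rewrite (svalP (div_a _)) scalerDr scalerA mulrC.
  by rewrite -scalerA !(svalP (div_a _)) linearP.
have agE x : f x = g (a *: x) by rewrite linearZ /= gE (svalP (div_a _)).
have gd x : g (chdiff F p x) = 0.
  by apply: inj_a; rewrite scaler0 -linearZ -agE.
case: p f fd g gE agE gd => [|p] f fd g gE agE gd.
  move=> x; have [s sE] := annihilator_homotopy0.
  by rewrite agE sE gd.
have [s [t st]] := annihilator_homotopy p.
by exists (linear_comp g s) => x; rewrite agE st linearD /= gd add0r.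
Qed.

End Annihilated.

(** * Isomorphism on Ext induced by an injection [u] with [a] bijective on its cokernel *)

Section ExtIso.
Variables (N : lmodType R) (F : projective_resolution N) (a : R).
Hypothesis aN : forall y : N, a *: y = 0.
Variables (A B : lmodType R) (u : {linear A -> B}).
Hypothesis inj_u : injective u.
Hypothesis a_surj : forall b, exists b' x, b = a *: b' + u x.
Hypothesis a_inj : forall b x, a *: b = u x -> exists y, b = u y.

Let Q := quotient_module (range_pred u).
Let q : {linear B -> Q} := quotient_proj (range_pred u).

Let qu x : q (u x) = 0.
Proof. by apply/quotient_proj_eq0; exact: mem_range_pred. Qed.

Let q0P b : q b = 0 -> exists x, u x = b.
Proof. by move/quotient_proj_eq0/asboolP. Qed.

Let a_bij (y : Q) : exists! y', a *: y' = y.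
Proof.
have [b <-] := quotient_proj_surj y; have [b' [x bE]] := a_surj b.
exists (q b'); split; first by rewrite bE linearD /= -/q qu addr0 linearZ.
move=> z; have [c <-] := quotient_proj_surj z; rewrite -/q => cb.
have /q0P[v vE] : q (a *: c - b) = 0 by rewrite linearB linearZ /= -/q cb subrr.
have [|w wE] := @a_inj (c - b') (v + x).
  by rewrite scalerBr linearD vE bE opprD addrA subrK.
by apply/esym/eqP; rewrite -subr_eq0 -linearB /= wE qu.
Qed.

Lemma lift_to_submodule p (f : {linear F p -> B}) : (forall x, q (f x) = 0) ->
  exists g : {linear F p -> A}, forall x, u (g x) = f x.
Proof.
move=> qf; apply: projective_lift; first exact: pres_projective.
by move=> x; exact/q0P/qf.
Qed.

Lemma lift_from_quotient p (f : {linear F p -> Q}) :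
  exists g : {linear F p -> B}, forall x, q (g x) = f x.
Proof.
apply: projective_lift; first exact: pres_projective.
by move=> x; exact: quotient_proj_surj.
Qed.

(** Surjectivity on cohomology: the image of [f] in [Q] is a coboundary, its bounding cochain lifts
    to [B] by projectivity, and subtracting the resulting coboundary moves [f] into [A]. *)
Lemma ext_surj p (f : {linear F p -> B}) : (forall x, f (chdiff F p x) = 0) ->
  exists2 g : {linear F p -> A}, forall x, g (chdiff F p x) = 0 &
    exists2 h : {linear F p -> B}, hom_coboundary h & forall x, f x = u (g x) + h x.
Proof.
move=> fd.
suff [h hB qfh] : exists2 h : {linear F p -> B}, hom_coboundary h &
    forall x, q (f x) = q (h x).
  have [|m mE] := @linear_bundle R (F p) B (fun x => f x - h x).
    by move=> c x y; rewrite (linearP f) (linearP h) scalerBr opprD addrACA.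
  have [|g gE] := @lift_to_submodule p m.
    by move=> x; rewrite mE linearB /= qfh subrr.
  exists g => [x|]; last by exists h => // x; rewrite gE mE subrK.
  apply: inj_u; rewrite gE mE fd linear0.
  case: p f fd h hB {qfh m mE g gE} x => [|p] f fd h /= hB x.
    by rewrite hB subr0.
  by have [k ->] := hB; rewrite chdiffK linear0 subr0.
have qfd : forall x, (linear_comp q f) (chdiff F p x) = 0.
  by move=> x; rewrite /= fd linear0.
have := hom_cohomology_eq0 aN a_bij qfd; case: p f fd qfd => [|p] f fd qfd /=.
  by move=> qf0; exists (@linear_zero R _ _) => // x; rewrite qf0 linear0.
move=> [w wE]; have [k kE] := lift_from_quotient w.
by exists (linear_comp k (chdiff F p)) => [|x]; [exists k | rewrite /= kE wE].
Qed.

(** Injectivity on cohomology: if [g] bounds the composite of [u] and [f], then [g] is a cocycle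
    modulo [A], hence congruent to a cocycle [h] of [B]; the difference [g - h] takes values in [A]
    and has the same coboundary as [g]. *)
Lemma ext_inj p (f : {linear F p -> A}) : (forall x, f (chdiff F p x) = 0) ->
  hom_coboundary (linear_comp u f) -> hom_coboundary f.
Proof.
case: p f => [|p] f fd /=.
  by move=> uf x; apply: inj_u; rewrite linear0; exact: uf.
move=> [g gE].
have qgd : forall x, (linear_comp q g) (chdiff F p x) = 0.
  by move=> x; rewrite /linear_comp -[g _]gE; exact: qu.
have [h hB qgh] : exists2 h : {linear F p -> B},
    forall x, h (chdiff F p x) = 0 & forall x, q (g x) = q (h x).
  have := hom_cohomology_eq0 aN a_bij qgd;
    case: p f fd g gE qgd => [|p] f fd g gE qgd /=.
    by move=> qg0; exists (@linear_zero R _ _) => // x; rewrite qg0 linear0.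
  move=> [w wE]; have [k kE] := lift_from_quotient w.
  exists (linear_comp k (chdiff F p)) => x; rewrite /= /linear_comp.
    by rewrite chdiffK linear0.
  by rewrite [LHS]wE -kE.
have [|m mE] := @linear_bundle R (F p) B (fun x => g x - h x).
  by move=> c x y; rewrite (linearP g) (linearP h) scalerBr opprD addrACA.
have [|k kE] := @lift_to_submodule p m.
  by move=> x; rewrite mE linearB /= qgh subrr.
exists k => x; apply: inj_u; rewrite kE mE hB subr0; exact: gE.
Qed.

Lemma ext_iso p : exists h : {linear Ext F A p -> Ext F B p}, bijective h.
Proof.
(* Composition with [u]; elements of [hom_module] are functions with a proof of linearity, so a
   bundled linear map is chosen for each. *)
have [|hm hmE] := @linear_bundle R (hom_module (F p) A) (hom_module (F p) B)
  (fun phi => to_hom (linear_comp u (sval (cid (hom_linear phi))))).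
  move=> c phi psi; apply: val_inj; apply/funext => x /=.
  case: cid => f /= fE; case: cid => g /= gE; case: cid => h /= hE.
  have fx : f x = c *: g x + h x.
    by rewrite gE hE in fE; exact: esym (congr1 (fun k => val k x) fE).
  by rewrite /linear_comp fx; exact: linearP.
have hm_to (f : {linear F p -> A}) : hm (to_hom f) = to_hom (linear_comp u f).
  rewrite hmE; apply/to_hom_inj => x /=; case: cid => g /= gE.
  by rewrite /linear_comp; congr (u _); exact: esym (congr1 (fun k => val k x) gE).
have hmZ phi : phi \in cocycle (C := hom_complex F A) (i := p) ->
    hm phi \in cocycle (C := hom_complex F B) (i := p).
  have [f ->] := hom_linear phi; rewrite hm_to => /hom_cocycleP fd.
  by apply/hom_cocycleP => x; rewrite /= /linear_comp fd linear0.
apply: (quotient_iso (g := submodule_map hmZ)).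
  move=> phi; have [f fE] := hom_linear (val phi); split=> /asboolP.
    rewrite fE => /hom_coboundaryP fB; apply/asboolP; rewrite /= fE hm_to.
    apply/hom_coboundaryP; case: (p) f fB {fE} => [|r] f /= fB.
      by move=> x; rewrite /linear_comp fB linear0.
    have [g gE] := fB; exists (linear_comp u g) => x.
    by rewrite /= /linear_comp gE.
  rewrite /= fE hm_to => /hom_coboundaryP fB; apply/asboolP; rewrite fE.
  apply/hom_coboundaryP; apply: ext_inj fB; apply/hom_cocycleP.
  by rewrite -fE; exact: valP.
move=> phi; have [f fE] := hom_linear (val phi).
have [|g gd [h hB fgh]] := @ext_surj p f.
  by apply/hom_cocycleP; rewrite -fE; exact: valP.
have gZ : to_hom g \in cocycle (C := hom_complex F A) (i := p).
  exact/hom_cocycleP.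
exists (Submodule gZ); apply/asboolP; rewrite linearB /= hm_to fE.
have -> : to_hom f - to_hom (linear_comp u g) = to_hom h.
  apply: val_inj; apply/funext => x /=.
  transitivity (f x - u (g x)); first by [].
  by rewrite fgh addrC addKr.
exact/hom_coboundaryP.
Qed.

End ExtIso.
End ExtInvariance.

(** * Injectivity over the coefficient subring *)

(** Both sides sum [F i j l] over [i + j + l = k], grouped by [i] on the left and by [i + j] on the
    right. *)
Lemma convolutionA (V : nmodType) (F : nat -> nat -> nat -> V) (k : nat) :
  \sum_(i < k.+1) \sum_(j < (k - i).+1) F i j (k - i - j)%N =
  \sum_(l < k.+1) \sum_(i < l.+1) F i (l - i)%N (k - l)%N.
Proof.
elim: k F => [|k IHk] F; first by rewrite !big_ord1.
rewrite big_ord_recl [RHS]big_ord_recl big_ord1 /= subn0.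
under [in RHS]eq_bigr => l _.
  rewrite big_ord_recl /= subn0 /bump /= !add1n subSS.
  under eq_bigr => i _ do rewrite add1n subSS.
  over.
rewrite big_split /= addrA big_ord_recl /= subn0; congr (_ + _ + _).
under eq_bigr => i _ do rewrite /= /bump /= !add1n !subSS.
exact: IHk (fun i => F i.+1).
Qed.

Lemma sum_ord_trunc (V : nmodType) (f : nat -> V) (n N : nat) : (n <= N)%N ->
  (forall j, (n <= j)%N -> f j = 0) -> \sum_(j < N) f j = \sum_(j < n) f j.
Proof.
move=> leqnN f0; rewrite (big_ord_widen _ _ leqnN) [RHS]big_mkcond /=.
by apply: eq_bigr => j _; case: ltnP => // /f0.
Qed.

Lemma convolution_sum (V : nmodType) (F : nat -> nat -> V) (m n N : nat) :
    (m + n <= N)%N -> (forall i j, (m <= i)%N || (n <= j)%N -> F i j = 0) ->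
  \sum_(k < N) \sum_(i < k.+1) F i (k - i)%N = \sum_(i < m) \sum_(j < n) F i j.
Proof.
case: N => [|N].
  by rewrite leqn0 addn_eq0 => /andP[/eqP-> /eqP->]; rewrite !big_ord0.
move=> mnN F0; rewrite -(convolutionA (fun i j _ => F i j)).
rewrite (@sum_ord_trunc _ (fun i => \sum_(j < (N - i).+1) F i j) m).
- apply: eq_bigr => i _; apply: sum_ord_trunc => [|j nj].
    by have := ltn_ord i; lia.
  by rewrite F0 // nj orbT.
- exact: leq_trans (leq_addr _ _) mnN.
- by move=> i mi; apply: big1 => j _; rewrite F0 ?mi.
Qed.

Section RelativeInjectivity.
Variables (R : comNzRingType) (x : R) (expand : {rmorphism R -> {poly R}}).
Hypothesis expandK : forall p, (expand p).[x] = p.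
Hypothesis expand_coef : forall p i, expand (expand p)`_i = ((expand p)`_i)%:P.

(** Linearity over the subring of elements that [expand] sends to constants. When [expand] writes a
    polynomial in powers of [x], these are the elements free of [x]. *)
Definition rel_linear (M N : lmodType R) (g : M -> N) : Prop :=
  forall c m m', expand c = c%:P -> g (c *: m + m') = c *: g m + g m'.

Section RelLinearTheory.
Variables (M N : lmodType R) (g : M -> N).
Hypothesis glin : rel_linear g.

Lemma rel_linearD : {morph g : m m' / m + m'}.
Proof. by move=> m m'; have := glin m m' (rmorph1 expand); rewrite !scale1r. Qed.

Lemma rel_linear0 : g 0 = 0.
Proof. by apply: (addIr (g 0)); rewrite -rel_linearD !add0r. Qed.

Lemma rel_linear_sum (I : Type) (r : seq I) (F : I -> M) :
  g (\sum_(i <- r) F i) = \sum_(i <- r) g (F i).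
Proof. exact: (big_morph g rel_linearD rel_linear0). Qed.

Lemma rel_linearZ c m : expand c = c%:P -> g (c *: m) = c *: g m.
Proof.
by move=> cE; have := glin m 0 cE; rewrite rel_linear0 !addr0.
Qed.

End RelLinearTheory.

Lemma linear_rel_linear (M N : lmodType R) (g : {linear M -> N}) : rel_linear g.
Proof. by move=> c m m' _; rewrite linearP. Qed.

Lemma rel_linear_comp (M N L : lmodType R) (g : N -> L) (f : M -> N) :
  rel_linear g -> rel_linear f -> rel_linear (g \o f).
Proof. by move=> lg lf c m m' cE /=; rewrite lf // lg. Qed.

Lemma rel_linear_sub (M N : lmodType R) (g f : M -> N) :
  rel_linear g -> rel_linear f -> rel_linear (fun m => g m - f m).
Proof. by move=> lg lf c m m' cE /=; rewrite lf // lg // scalerBr opprD addrACA. Qed.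

Lemma expand_scale (M : lmodType R) p (m : M) :
  p *: m = \sum_(i < size (expand p)) (x ^+ i * (expand p)`_i) *: m.
Proof.
rewrite -scaler_suml -[p in LHS]expandK horner_coef; congr (_ *: _).
by apply: eq_bigr => i _; rewrite mulrC.
Qed.

(* Power series with coefficients in [A], on which [R] acts through [expand]:
   [x] shifts, and elements free of [x] act coefficientwise. *)
Definition seqmod (A : lmodType R) : Type := nat -> A.

HB.instance Definition _ A := GRing.Zmodule.on (seqmod A).

Section SeqMod.
Variable A : lmodType R.

Definition seqmod_scale (p : R) (a : seqmod A) : seqmod A :=
  fun k => \sum_(i < k.+1) (expand p)`_i *: a (k - i)%N.

Let seqmod_scaleA p q a :
  seqmod_scale p (seqmod_scale q a) = seqmod_scale (p * q) a.
Proof.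
apply/funext => k; rewrite /seqmod_scale.
pose F i j l := ((expand p)`_i * (expand q)`_j) *: a l.
transitivity (\sum_(i < k.+1) \sum_(j < (k - i).+1) F i j (k - i - j)%N).
  apply: eq_bigr => i _; rewrite scaler_sumr; apply: eq_bigr => j _.
  by rewrite scalerA.
rewrite convolutionA; apply: eq_bigr => l _.
by rewrite rmorphM coefM scaler_suml.
Qed.

Let seqmod_scale1 : left_id 1 seqmod_scale.
Proof.
move=> a; apply/funext => k; rewrite /seqmod_scale rmorph1 big_ord_recl coefC.
rewrite scale1r subn0 big1 ?addr0 // => i _.
by rewrite coefC scale0r.
Qed.

Let seqmod_scaleDr : right_distributive seqmod_scale +%R.
Proof.
move=> p a b; apply/funext => k; rewrite /seqmod_scale -[RHS]big_split /=.
by apply: eq_bigr => i _; rewrite -scalerDr.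
Qed.

Let seqmod_scaleDl a : {morph seqmod_scale^~ a : p q / p + q}.
Proof.
move=> p q; apply/funext => k; rewrite /seqmod_scale -[RHS]big_split /=.
by apply: eq_bigr => i _; rewrite rmorphD coefD scalerDl.
Qed.

HB.instance Definition _ := GRing.Zmodule_isLmodule.Build R (seqmod A)
  seqmod_scaleA seqmod_scale1 seqmod_scaleDr seqmod_scaleDl.

Definition polymod_pred : {pred seqmod A} :=
  fun a => `[< exists n, forall k, (n <= k)%N -> a k = 0 >].

Let polymod_closed : submod_closed polymod_pred.
Proof.
split=> [|p a b /asboolP[m am] /asboolP[n bn]]; apply/asboolP.
  by exists 0%N.
exists (maxn (size (expand p) + m) n) => k; rewrite geq_max => /andP[mk nk].
rewrite [LHS](_ : _ = seqmod_scale p a k + b k) // bn // addr0.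
apply: big1 => i _; have [si|si] := leqP (size (expand p)) i.
  by rewrite nth_default ?scale0r.
by rewrite am ?scaler0 //; lia.
Qed.

HB.instance Definition _ := GRing.isSubmodClosed.Build R (seqmod A) polymod_pred
  polymod_closed.

(** For [R] a polynomial ring in [x] over the elements free of [x], this is the extension of scalars
    of [A] from that subring to [R]. *)
Definition polymod : lmodType R := submodule polymod_pred.

Lemma polymod_bound (a : polymod) :
  {n | forall k, (n <= k)%N -> val a k = 0}.
Proof. by apply: cid; apply/asboolP; exact: valP a. Qed.

Let const_seq (a : A) : seqmod A := fun k => if k is 0 then a else 0.

Let const_seq_pred a : const_seq a \in polymod_pred.
Proof. by apply/asboolP; exists 1%N => -[]. Qed.

Definition polymod_const a : polymod := Submodule (const_seq_pred a).

Lemma polymod_const_rel_linear : rel_linear polymod_const.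
Proof.
move=> c a b cE; apply: val_inj; apply/funext => -[|k] /=.
  rewrite [RHS](_ : _ = seqmod_scale c (const_seq a) 0%N + b) //.
  by rewrite /seqmod_scale big_ord1 cE coefC.
rewrite [RHS](_ : _ = seqmod_scale c (const_seq a) k.+1 + 0) // addr0.
apply/esym/big1 => i _; rewrite cE coefC.
case: (i : nat) => [|j] /=; last by rewrite scale0r.
by rewrite scaler0.
Qed.

Section Eval.
Variables (E : lmodType R) (g : A -> E).
Hypothesis glin : rel_linear g.

(** The universal property of extension of scalars. Any bound [n] on the support is allowed, so that
    sums of different lengths can be compared. *)
Lemma polymod_eval : exists G : {linear polymod -> E},
  (forall (a : polymod) n, (forall k, (n <= k)%N -> val a k = 0) ->
     G a = \sum_(k < n) x ^+ k *: g (val a k)).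
Proof.
pose G (a : polymod) := \sum_(k < sval (polymod_bound a)) x ^+ k *: g (val a k).
have GE (a : polymod) n : (forall k, (n <= k)%N -> val a k = 0) ->
    G a = \sum_(k < n) x ^+ k *: g (val a k).
  rewrite /G; case: polymod_bound => m am an; rewrite [sval _]/=.
  transitivity (\sum_(k < maxn m n) x ^+ k *: g (val a k)).
    rewrite (@sum_ord_trunc _ (fun k => x ^+ k *: g (val a k)) m (maxn m n)) ?leq_maxl //.
    by move=> j /am->; rewrite rel_linear0 ?scaler0.
  rewrite (@sum_ord_trunc _ (fun k => x ^+ k *: g (val a k)) n (maxn m n)) ?leq_maxr //.
  by move=> j /an->; rewrite rel_linear0 ?scaler0.
have [|G' G'E] := @linear_bundle R polymod E G; last first.
  by exists G' => a n an; rewrite G'E; exact: GE.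
move=> p a b.
have [m am] := polymod_bound a; have [n bn] := polymod_bound b.
(* A common bound: [p *: a] vanishes from [size (expand p) + m] on and [b] from [n] on. *)
pose N := (size (expand p) + m + n)%N.
have valE k : val (p *: a + b) k = seqmod_scale p (val a) k + val b k by [].
rewrite (GE _ N); last first.
  move=> k Nk; rewrite valE bn ?addr0; last by rewrite /N in Nk; lia.
  apply: big1 => i _; have [si|si] := leqP (size (expand p)) i.
    by rewrite nth_default ?scale0r.
  by rewrite am ?scaler0 //; rewrite /N in Nk; lia.
rewrite (GE a m am) (GE b N); last by move=> k Nk; apply: bn; rewrite /N in Nk; lia.
pose F i j := (x ^+ i * (expand p)`_i) *: (x ^+ j *: g (val a j)).
transitivity (\sum_(k < N) (\sum_(i < k.+1) F i (k - i)%N + x ^+ k *: g (val b k))).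
  apply: eq_bigr => k _; rewrite valE (rel_linearD glin) scalerDr; congr (_ + _).
  rewrite (rel_linear_sum glin) scaler_sumr; apply: eq_bigr => i _.
  rewrite (rel_linearZ glin) ?expand_coef // /F !scalerA; congr (_ *: _).
  by rewrite mulrAC -exprD subnKC // -ltnS.
rewrite big_split /=; congr (_ + _).
rewrite (@convolution_sum _ F (size (expand p)) m) ?leq_addr //; last first.
  move=> i j /orP[si|mj]; rewrite /F.
    by rewrite nth_default // mulr0 scale0r.
  by rewrite am // rel_linear0 // !scaler0.
rewrite expand_scale; apply: eq_bigr => i _; rewrite scaler_sumr.
by apply: eq_bigr => j _.
Qed.

End Eval.
End SeqMod.

Lemma polymod_map (A B : lmodType R) (d : {linear A -> B}) :
  exists D : {linear polymod A -> polymod B},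
    forall (a : polymod A) k, val (D a) k = d (val a k).
Proof.
have [|D DE] := @linear_bundle R (seqmod A) (seqmod B) (fun a k => d (a k)).
  move=> p a b; apply/funext => k.
  rewrite [LHS](_ : _ = d (seqmod_scale p a k + b k)) // linearD; congr (_ + _).
  by rewrite linear_sum; apply: eq_bigr => i _; rewrite linearZ.
have Dpred a : a \in @polymod_pred A -> D a \in @polymod_pred B.
  move=> /asboolP[n an]; apply/asboolP; exists n => k /an ak.
  by rewrite DE ak linear0.
by exists (submodule_map Dpred) => a k /=; rewrite DE.
Qed.

(* [R] is free over its subring of elements free of [x], so an injective
   [R]-module is also injective over that subring. *)
Lemma rel_injective_extend (A B E : lmodType R) (d : {linear A -> B})
    (g : A -> E) : injective_module E -> rel_linear g ->
    (forall a, d a = 0 -> g a = 0) ->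
  exists2 h : B -> E, rel_linear h & forall a, h (d a) = g a.
Proof.
move=> injE glin gd.
have [D DE] := polymod_map d; have [G GE] := polymod_eval glin.
have [a Da0|H HE] := injective_extend (d := D) (f := G) injE.
  have [n an] := polymod_bound a; rewrite (GE a n an) big1 // => k _.
  by rewrite gd ?scaler0 // -DE Da0.
exists (H \o @polymod_const B).
  apply: rel_linear_comp; first exact: linear_rel_linear.
  exact: polymod_const_rel_linear.
move=> a /=; have -> : polymod_const (d a) = D (polymod_const a).
  by apply: val_inj; apply/funext => k; rewrite DE; case: k => //=; rewrite linear0.
rewrite HE (GE _ 1%N); last by case.
by rewrite big_ord1 expr0 scale1r.
Qed.

End RelativeInjectivity.

(** * Torsion and local cohomology *)

Section IdealPowers.
Variable R : comNzRingType.
Implicit Types (J : ideal R) (S P : R -> Prop).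

Lemma ideal_gen_ind S P : P 0 ->
    (forall a f g, S f -> P g -> P (a * f + g)) ->
  forall f, f \in ideal_gen S -> P f.
Proof.
move=> P0 Plin f /asboolP[r Sr ->]; elim: r Sr => [|c r IHr] Sr.
  by rewrite big_nil.
rewrite big_cons; apply: Plin; first exact/Sr/mem_head.
by apply: IHr => d dr; apply: Sr; rewrite in_cons dr orbT.
Qed.

Lemma mem_ideal_gen S f : S f -> f \in ideal_gen S.
Proof.
move=> Sf; apply/asboolP; exists [:: (1, f)]; last by rewrite big_seq1 mul1r.
by move=> c; rewrite mem_seq1 => /eqP->.
Qed.

Lemma idealMl J a f : f \in J -> a * f \in J.
Proof. by move=> Jf; exact: (rpredZ a Jf). Qed.

Lemma ideal_pow0 J f : f \in ideal_pow J 0.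
Proof.
rewrite -[f]mulr1; apply: idealMl; apply: mem_ideal_gen.
by exists [tuple]; rewrite ?big_nil.
Qed.

Lemma ideal_powS J k a f : a \in J -> f \in ideal_pow J k -> a * f \in ideal_pow J k.+1.
Proof.
move=> Ja; elim/ideal_gen_ind=> [|c g h [t Jt ->] Jh].
  by rewrite mulr0 rpred0.
rewrite mulrDr mulrCA rpredD //; apply/idealMl/mem_ideal_gen.
exists [tuple of a :: t]; last by rewrite big_cons.
by move=> b; rewrite inE => /predU1P[->//|]; exact: Jt.
Qed.

(** Annihilation by the [k]-th power of [J], unfolded into [k] successive multiplications to suit
    induction on [k]. *)
Fixpoint killed J (M : lmodType R) (k : nat) (u : M) : Prop :=
  match k with
  | 0 => u = 0
  | l.+1 => forall a, a \in J -> killed J l (a *: u)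
  end.

Lemma killedZ J (M : lmodType R) k c (u : M) :
  killed J k u -> killed J k (c *: u).
Proof.
elim: k u => /= [u ->|k IHk u uk a Ja]; first by rewrite scaler0.
by rewrite scalerA mulrC -scalerA; apply/IHk/uk.
Qed.

Lemma sub_killed J J' (M : lmodType R) k (u : M) :
  {subset J <= J'} -> killed J' k u -> killed J k u.
Proof. by move=> JJ'; elim: k u => //= k IHk u uk a /JJ'/uk; exact: IHk. Qed.

Lemma killedP J (M : lmodType R) k (u : M) :
  (forall a, a \in ideal_pow J k -> a *: u = 0) <-> killed J k u.
Proof.
split.
  elim: k u => [|k IHk] u uk /=.
    by rewrite -[u]scale1r uk // ideal_pow0.
  move=> a Ja; apply: IHk => b Jb; rewrite scalerA mulrC.
  exact/uk/ideal_powS.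
move=> uk a; elim/ideal_gen_ind=> [|c f g [t Jt ->] gu]; first by rewrite scale0r.
rewrite scalerDl gu addr0 -scalerA; suff -> : (\prod_(b <- t) b) *: u = 0.
  by rewrite scaler0.
elim: k t Jt u uk {gu} => [|k IHk] t Jt u /=.
  by rewrite tuple0 => ->; rewrite scaler0.
case/tupleP: t Jt => b t Jt uk; rewrite big_cons mulrC -scalerA.
apply: IHk; last by apply: uk; rewrite Jt ?mem_head.
by move=> d dt; apply: Jt; rewrite inE dt orbT.
Qed.

Lemma torsionP J (M : lmodType R) (u : M) :
  u \in torsion J M <-> exists k, killed J k u.
Proof.
split=> [/asboolP[k uk]|[k uk]]; first by exists k; apply/killedP.
by apply/asboolP; exists k; apply/killedP.
Qed.

Lemma sub_torsion J J' (M : lmodType R) : {subset J <= J'} ->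
  {subset torsion J' M <= torsion J M}.
Proof. by move=> JJ' u /torsionP[k /(sub_killed JJ') uk]; apply/torsionP; exists k. Qed.

Lemma torsion_cancel J J' z (M : lmodType R) (u : M) :
    (forall a b, a \in J' -> b \in J' ->
       exists2 c, c \in J & exists e, a * b = c + e * z) ->
  u \in torsion J M -> z *: u \in torsion J' M -> u \in torsion J' M.
Proof.
move=> J'J /torsionP[l ul] /torsionP[k zuk].
(* Two factors from [J'] are traded for one from [J], since the multiple of [z] kills [w]; hence the
   doubling. *)
have kill0 m (w : M) : killed J m w -> z *: w = 0 -> killed J' m.*2 w.
  elim: m w => //= m IHm w wm zw a J'a b J'b; rewrite scalerA.
  have [c Jc [e ->]] := J'J _ _ J'b J'a.
  rewrite scalerDl -[(e * z) *: w]scalerA zw scaler0 addr0.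
  by apply: IHm; [exact: wm | rewrite scalerA mulrC -scalerA zw scaler0].
(* The first [k] factors from [J'] lead to an element killed by [z]; [kill0] accounts for the next
   [2 * l]. *)
apply/torsionP; exists (k + l.*2)%N; elim: k u ul zuk => [|k IHk] u ul /=.
  exact: kill0.
move=> zuk a J'a; apply: IHk; first exact: killedZ.
by rewrite scalerA mulrC -scalerA; exact: zuk.
Qed.

End IdealPowers.

(** * Division by [x] and its lift to injective resolutions *)

Section Expansion.
Variables (R : comNzRingType) (x : R) (expand : {rmorphism R -> {poly R}}).
Hypothesis expandK : forall p, (expand p).[x] = p.
Hypothesis expand_coef : forall p i, expand (expand p)`_i = ((expand p)`_i)%:P.
Hypothesis expand_x : expand x = 'X.

(* [p = (expand p)`_0 + x * quo p]. *)
Definition quo (p : R) : R := (drop_poly 1 (expand p)).[x].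

Lemma quo_eq p : p = (expand p)`_0 + x * quo p.
Proof.
rewrite -[LHS]expandK -{1}[expand p](poly_take_drop 1) hornerD hornerM hornerXn.
rewrite mulrC; congr (_ + _); rewrite /take_poly horner_poly big_ord1.
by rewrite mulr1.
Qed.

Lemma quoD p q : quo (p + q) = quo p + quo q.
Proof. by rewrite /quo rmorphD drop_polyD hornerD. Qed.

Lemma quo_mulx p : quo (x * p) = p.
Proof.
by rewrite /quo rmorphM expand_x mulrC -[X in _ * X]expr1 drop_polyMXn_id expandK.
Qed.

Lemma mulx_inj : injective ( *%R x).
Proof. by move=> p q pq; rewrite -[p]quo_mulx pq quo_mulx. Qed.

(** A twisted Leibniz rule: multiplied by [x] and completed by the constant coefficient, both sides
    become [p * q]. *)
Lemma quoM p q : quo (p * q) = quo p * q + (expand p)`_0 * quo q.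
Proof.
apply: mulx_inj; apply: (addrI (expand (p * q))`_0); rewrite -quo_eq rmorphM.
rewrite coefM big_ord1 subn0 mulrDr addrCA addrC mulrA mulrCA -mulrDr -quo_eq.
by rewrite -mulrDl -quo_eq.
Qed.

Lemma quo_rel_linear : rel_linear expand (quo : R^o -> R^o).
Proof.
move=> c p q cE; rewrite quoD; congr (_ + _).
rewrite [LHS]quoM cE coefC /= {1}/quo cE drop_poly_eq0 ?horner0 ?mul0r ?add0r //.
exact: size_polyC_leq1.
Qed.

Section Divisibility.
Variable J : ideal R.
Hypothesis J_coef0 : forall a, a \in J -> (expand a)`_0 \in J.

Lemma ideal_pow_coef0 k a : a \in ideal_pow J k -> (expand a)`_0 \in ideal_pow J k.
Proof.
elim/ideal_gen_ind=> [|c f g [t Jt ->] Jg]; first by rewrite rmorph0 coef0 rpred0.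
rewrite rmorphD coefD rpredD // rmorphM coefM big_ord1 idealMl //= {c g Jg f}.
elim: k t Jt => [|k IHk] t Jt; first exact: ideal_pow0.
case/tupleP: t Jt => b t Jt; rewrite big_cons rmorphM coefM big_ord1 /=.
apply: ideal_powS; first by rewrite J_coef0 // Jt // mem_head.
by apply: IHk => d dt; apply: Jt; rewrite inE dt orbT.
Qed.

(** By [quoM], each term divides at most one factor of a product, which may then leave [J]; the
    others stay in [J], possibly replaced by their constant coefficients. Hence the loss of one
    power. *)
Lemma quo_ideal_pow k a : a \in ideal_pow J k.+1 -> quo a \in ideal_pow J k.
Proof.
have prod_pow m (t : m.-tuple R) : (forall b, b \in t -> b \in J) ->
    \prod_(b <- t) b \in ideal_pow J m.
  by move=> Jt; apply: mem_ideal_gen; exists t.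
have quo_prod m (t : m.+1.-tuple R) : (forall b, b \in t -> b \in J) ->
    quo (\prod_(b <- t) b) \in ideal_pow J m.
  elim: m t => [|m IHm] t Jt; first exact: ideal_pow0.
  case/tupleP: t Jt => b t Jt; rewrite big_cons /= quoM.
  have Jb : b \in J by rewrite Jt // mem_head.
  have Jt' d : d \in t -> d \in J by move=> dt; apply: Jt; rewrite inE dt orbT.
  apply: rpredD; first exact/idealMl/prod_pow.
  by apply: ideal_powS; [exact: J_coef0 | exact: IHm].
elim/ideal_gen_ind=> [|c f g [t Jt ->] Jg].
  by rewrite /quo rmorph0 drop_poly0r horner0 rpred0.
rewrite quoD; apply: rpredD => //; rewrite quoM.
apply: rpredD; apply: idealMl; last exact: quo_prod.
by apply: (@ideal_powD R J k 1); rewrite addn1; exact: prod_pow.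
Qed.

Lemma torsion_divisible (E : lmodType R) (u : E) : injective_module E ->
  u \in torsion J E -> exists2 v, v \in torsion J E & x *: v = u.
Proof.
move=> injE /torsionP[k /killedP uk].
(* On this ideal [p |-> quo p *: u] is linear: the extra term of [quoM] contains the constant
   coefficient of [p], which kills [u]. The ideal contains [x], and [quo x = 1], so the value at 1
   of an extension to [R] is a quotient of [u] by [x]. *)
pose A : {pred R^o} := fun p => (expand p)`_0 \in ideal_pow J k.
have A_closed : submod_closed A.
  split=> [|c p q Ap Aq]; rewrite unfold_in; first by rewrite rmorph0 coef0 rpred0.
  rewrite rmorphD coefD; apply: rpredD => //.
  by rewrite rmorphM coefM big_ord1; apply: idealMl.
pose As : ideal R := HB.pack_for (ideal R) A
  (GRing.isSubmodClosed.Build R R^o A A_closed).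
have [|g gE] := @linear_bundle R (submodule As) E (fun p => quo (val p) *: u).
  move=> c p q; rewrite quoD scalerDl; congr (_ + _).
  transitivity (quo (val p * c) *: u); first by rewrite mulrC.
  have -> : quo (val p * c) *: u = (quo (val p) * c) *: u.
    rewrite quoM scalerDl [_ * quo c]mulrC -[(quo c * _) *: u]scalerA (uk (expand _)`_0).
      by rewrite scaler0 addr0.
    exact: (valP p).
  by rewrite scalerA mulrC.
have [|i iE] := @linear_bundle R (submodule As) R^o val; first by [].
have [|G GE] := injE _ _ i g; first by move=> p q; rewrite !iE => /val_inj.
have GA p : p \in A -> p *: G 1 = quo p *: u.
  move=> Ap; have := GE (Submodule (Ap : p \in As)); rewrite gE iE /= => <-.
  by rewrite -linearZ; congr (G _); rewrite /GRing.scale /= mulr1.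
exists (G 1); last first.
  rewrite GA; first by rewrite -[x]mulr1 quo_mulx scale1r.
  by rewrite unfold_in expand_x coefX rpred0.
(* One power more than for [u], since [quo] lowers the power by one. *)
apply/torsionP; exists k.+1; apply/killedP => b Jb.
rewrite GA ?uk ?quo_ideal_pow // unfold_in.
apply: ideal_pow_coef0; apply: (@ideal_powD R J k 1); by rewrite addn1.
Qed.

End Divisibility.

Section Stability.
Variable J : ideal R.
Hypothesis J_coef : forall a, a \in J -> forall i, (expand a)`_i \in J.

Lemma ideal_pow_coef k a i : a \in ideal_pow J k -> (expand a)`_i \in ideal_pow J k.
Proof.
move=> Ja; elim/ideal_gen_ind: Ja i => {a} [|c f g [t Jt ->] Jg] i.
  by rewrite rmorph0 coef0 rpred0.
rewrite rmorphD coefD; apply: rpredD => //; rewrite rmorphM coefM.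
apply: rpred_sum => j _; apply: idealMl; move: (i - j)%N => {}i {j c g Jg f}.
elim: k t Jt i => [|k IHk] t Jt i; first exact: ideal_pow0.
case/tupleP: t Jt => b t Jt; rewrite big_cons rmorphM coefM /=.
apply: rpred_sum => j _; apply: ideal_powS.
  by apply: J_coef; rewrite Jt // mem_head.
by apply: IHk => d dt; apply: Jt; rewrite inE dt orbT.
Qed.

(** An element of a power of [J] expands into powers of [x] with coefficients in the same power of
    [J], and [g] commutes with these coefficients. *)
Lemma rel_linear_torsion (M N : lmodType R) (g : M -> N) (u : M) :
  rel_linear expand g -> u \in torsion J M -> g u \in torsion J N.
Proof.
move=> glin /torsionP[k /killedP uk]; apply/torsionP; exists k.
apply/killedP => a Ja; rewrite (expand_scale expandK) big1 // => i _.
rewrite -scalerA -(rel_linearZ glin) ?expand_coef // uk ?(rel_linear0 glin) ?scaler0 //.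
exact: ideal_pow_coef.
Qed.

Section Cohomology.
Variable I : injective_resolution R^o.

(* A lift of [quo] to the resolution, with a homotopy from its composite with
   multiplication by [x] to the identity. *)
Lemma quo_lift j :
  exists (D : I j -> I j) (D' : I j.+1 -> I j.+1) (h : I j.+1 -> I j),
  [/\ rel_linear expand D, rel_linear expand D', rel_linear expand h,
      forall w, D' (codiff I j w) = codiff I j (D w) &
      forall w, codiff I j.+1 w = 0 ->
        D' (x *: w) - w = codiff I j (h w)].
Proof.
have extend (A B : lmodType R) i (d : {linear A -> B}) (g : A -> I i) :
    rel_linear expand g -> (forall a, d a = 0 -> g a = 0) ->
    exists2 h : B -> I i, rel_linear expand h & forall a, h (d a) = g a.
  exact: (rel_injective_extend expandK expand_coef (@ires_injective _ _ I i)).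
have mulx_lin (M : lmodType R) : rel_linear expand (fun m : M => x *: m).
  by move=> c m m' _; rewrite scalerDr !scalerA mulrC.
elim: j => [|j [D [D' [h [linD linD' linh D'd hP]]]]].
  have linaq : rel_linear expand (fun p : R^o => ires_aug I (quo p)).
    by move=> c p q cE; rewrite (quo_rel_linear p q cE) linearP.
  have [|D linD Daug] := extend _ _ _ (ires_aug I) _ linaq.
    move=> p pI; have -> : p = 0 by apply: (@ires_aug_inj _ _ I); rewrite linear0.
    by rewrite (rel_linear0 quo_rel_linear) linear0.
  have [|D' linD' D'd] := extend _ _ _ (codiff I 0) _
      (rel_linear_comp (linear_rel_linear (codiff I 0)) linD).
    move=> w /ires_exact0[p <-] /=; rewrite Daug.
    by apply/ires_exact0; exists (quo p).
  have [|h linh hd] := extend _ _ _ (codiff I 0) (fun w => D (x *: w) - w)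
      (rel_linear_sub (rel_linear_comp linD (mulx_lin _))
         (linear_rel_linear (idfun : {linear _ -> _}))).
    move=> w /ires_exact0[p <-]; rewrite -linearZ Daug.
    by rewrite [quo _]quo_mulx subrr.
  exists D, D', h; split=> // w /ires_exact[v <-].
  by rewrite -linearZ D'd /= hd linearB.
have [|D'' linD'' D''d] := extend _ _ _ (codiff I j.+1) _
    (rel_linear_comp (linear_rel_linear (codiff I j.+1)) linD').
  by move=> w /ires_exact[v <-] /=; rewrite D'd codiffK.
(* By the induction hypothesis this map vanishes on cocycles, so it factors through the differential
   as [h']. *)
have [|h' linh' h'd] := extend _ _ _ (codiff I j.+1)
    (fun w => D' (x *: w) - w - codiff I j (h w))
    (rel_linear_sub (rel_linear_sub (rel_linear_comp linD' (mulx_lin _))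
       (linear_rel_linear (idfun : {linear _ -> _})))
      (rel_linear_comp (linear_rel_linear (codiff I j)) linh)).
  by move=> w /hP ->; rewrite subrr.
exists D', D'', h'; split=> // w /ires_exact[v <-].
by rewrite -linearZ D''d /= h'd !linearB /= codiffK subr0.
Qed.

(** Coboundaries of the torsion complex, described by elements of [I j] instead of nested subtypes;
    [mem_coboundary] is the translation. *)
Definition torsion_coboundary (L : ideal R) j : I j -> Prop :=
  match j with
  | 0 => fun u => u = 0
  | i.+1 => fun u => exists2 v, v \in torsion L (I i) & codiff I i v = u
  end.

(** This makes [x] a nonzerodivisor on cohomology. If [x *: u = d v], the homotopy of [quo_lift]
    gives [u = d (D v - h u)], and [D], [h] preserve torsion by [rel_linear_torsion]. In degree 0
    the factor [x] cancels in [R]. *)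
Lemma torsion_coboundary_regular j (u : I j) :
    u \in torsion J (I j) -> codiff I j u = 0 ->
  torsion_coboundary J (x *: u) -> torsion_coboundary J u.
Proof.
case: j u => [|j] u Ju du /=.
  have [p <-] : exists p, ires_aug I p = u by apply/ires_exact0.
  rewrite -linearZ => xp0; rewrite (_ : p = 0) ?linear0 //.
  apply: mulx_inj; rewrite mulr0; apply: (@ires_aug_inj _ _ I).
  by rewrite linear0 -[RHS]xp0.
case=> v Jv dv; have [D [D' [h [linD _ linh D'd hP]]]] := quo_lift j.
exists (D v - h u); first by apply: rpredB; exact: rel_linear_torsion.
by rewrite linearB /= -D'd dv -hP // subKr.
Qed.

(** * Comparison of local cohomology for [J] and a smaller ideal [L] *)

Section Comparison.
Variables (L : ideal R) (z : R).
Hypothesis LJ : {subset L <= J}.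
Hypothesis xJ_L : forall a, a \in J -> x * a \in L.
Hypothesis J2_L : forall a b, a \in J -> b \in J ->
  exists2 c, c \in L & exists e, a * b = c + e * z.
Hypothesis z_div : forall j (u : I j), u \in torsion L (I j) ->
  exists2 v, v \in torsion L (I j) & z *: v = u.

Let torsionJL j : {subset torsion J (I j) <= torsion L (I j)}.
Proof. exact: sub_torsion. Qed.

Lemma torsion_coboundary_sub j (u : I j) :
  torsion_coboundary J u -> torsion_coboundary L u.
Proof. by case: j u => //= j u [v Jv <-]; exists v => //; exact: torsionJL. Qed.

(** If [u = d v] with [v] killed by the [k]-th power of [L], then [x ^+ k *: v] is [J]-torsion
    because [x J <= L]. So [x ^+ k *: u] bounds over [J], and the factors [x] cancel one at a
    time. *)
Lemma torsion_coboundary_inj j (u : I j) :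
    u \in torsion J (I j) -> codiff I j u = 0 ->
  torsion_coboundary L u -> torsion_coboundary J u.
Proof.
case: j u => [|j] u Ju du // [v /torsionP[k vk] dv].
have Jxv : x ^+ k *: v \in torsion J (I j).
  apply/torsionP; exists k; elim: k v vk {dv} => [|k IHk] v /= vk.
    by rewrite vk scaler0.
  move=> a Ja; rewrite scalerA (_ : a * x ^+ k.+1 = x ^+ k * (x * a)).
    by rewrite -scalerA; apply: IHk; exact/vk/xJ_L.
  by rewrite exprSr mulrC -mulrA.
have: torsion_coboundary J (x ^+ k *: u).
  by exists (x ^+ k *: v) => //; rewrite linearZ /= dv.
elim: k {Jxv vk} => [|k IHk]; first by rewrite expr0 scale1r.
rewrite exprS -scalerA => /torsion_coboundary_regular xu; apply/IHk/xu.
  exact: rpredZ.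
by rewrite linearZ /= du scaler0.
Qed.

(* A class [u] with [u = z *: v] has [codiff v] killed by [z]; this cocycle is
   [J]-torsion and bounds over [L], hence over [J], so [v] can be corrected. *)
Lemma z_div_cocycle j (u : I j) : u \in torsion L (I j) -> codiff I j u = 0 ->
  exists v w, [/\ v \in torsion L (I j), codiff I j v = 0,
    w \in torsion J (I j), codiff I j w = 0 & u = z *: v + w].
Proof.
move=> Lu du; have [v Lv zv] := z_div Lu.
have zdv : z *: codiff I j v = 0 by rewrite -linearZ /= zv.
have Ldv : codiff I j v \in torsion L (I j.+1) by exact: torsion_morph.
have [|||w Jw dw] := @torsion_coboundary_inj j.+1 (codiff I j v).
- by apply: torsion_cancel J2_L Ldv _; rewrite zdv; exact: rpred0.
- exact: codiffK.
- by exists v.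
exists (v - w), (z *: w); split.
- by apply: rpredB => //; exact: torsionJL.
- by rewrite linearB /= dw subrr.
- exact: rpredZ.
- by rewrite linearZ /= dw.
- by rewrite scalerBr subrK.
Qed.

(** With [z u - w = d s] and [s = z t], multiplication by [z] takes the cocycle [u - d t] to the
    [J]-torsion element [w], so [u - d t] is itself [J]-torsion by [torsion_cancel]. *)
Lemma z_inj_cocycle j (u w : I j) : u \in torsion L (I j) -> codiff I j u = 0 ->
    w \in torsion J (I j) -> codiff I j w = 0 ->
    torsion_coboundary L (z *: u - w) ->
  exists w', [/\ w' \in torsion J (I j), codiff I j w' = 0 &
    torsion_coboundary L (u - w')].
Proof.
case: j u w => [|j] u w Lu du Jw dw /=.
  move=> /eqP; rewrite subr_eq0 => /eqP zu; exists u; split=> //.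
    by apply: torsion_cancel J2_L Lu _; rewrite zu.
  by rewrite subrr.
case=> s Ls ds; have [t Lt zt] := z_div Ls.
exists (u - codiff I j t); split; last by exists t => //; rewrite subKr.
  apply: (torsion_cancel J2_L (z := z)).
    by apply: rpredB => //; exact: torsion_morph.
  by rewrite scalerBr -linearZ /= zt ds subKr.
by rewrite linearB /= codiffK subr0.
Qed.

Lemma mk_cocycle (A : ideal R) j (u : I j) : u \in torsion A (I j) ->
    codiff I j u = 0 ->
  {c : submodule (cocycle (C := torsion_complex A I) (i := j)) | val (val c) = u}.
Proof.
move=> Au du; have cu : (Submodule Au : torsion_complex A I j) \in
    cocycle (C := torsion_complex A I) (i := j).
  by rewrite unfold_in; apply/eqP; apply: val_inj.
by exists (Submodule cu).
Qed.

Lemma cocycle_val (A : ideal R) j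
    (c : submodule (cocycle (C := torsion_complex A I) (i := j))) :
  val (val c) \in torsion A (I j) /\ codiff I j (val (val c)) = 0.
Proof.
split; first exact: valP.
by have /eqP/(congr1 val) := valP c.
Qed.

Lemma mem_coboundary (A : ideal R) j
    (c : submodule (cocycle (C := torsion_complex A I) (i := j))) :
  c \in coboundary (C := torsion_complex A I) (i := j) <->
  torsion_coboundary A (val (val c)).
Proof.
rewrite unfold_in; split=> [/asboolP|]; last move=> cB; last apply/asboolP.
  case: j c => [|j] c /=; first by move=> ->.
  by case=> v /(congr1 val) <-; exists (val v) => //; exact: valP.
case: j c cB => [|j] c /=; first by move=> c0; apply: val_inj.
by case=> v Av dv; exists (Submodule Av); apply: val_inj.
Qed.

(** The clauses have the form required by [ext_iso]: besides injectivity, they express without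
    quotients that [z] acts bijectively on the cokernel of [f]. *)
Lemma local_cohomology_comparison j :
  exists f : {linear local_cohomology J I j -> local_cohomology L I j},
  [/\ injective f, forall b, exists b' y, b = z *: b' + f y &
      forall b y, z *: b = f y -> exists y', b = f y'].
Proof.
pose inc := submodule_map (f := (idfun : {linear I j -> I j})) (@torsionJL j).
have incZ c : c \in cocycle (C := torsion_complex J I) (i := j) ->
    inc c \in cocycle (C := torsion_complex L I) (i := j).
  move=> /eqP/(congr1 val) dc; rewrite unfold_in; apply/eqP; exact: val_inj.
have [|f fE] := quotient_map (g := submodule_map incZ)
    (S := coboundary (C := torsion_complex J I) (i := j))
    (T := coboundary (C := torsion_complex L I) (i := j)).
  by move=> c /mem_coboundary cB; apply/mem_coboundary/torsion_coboundary_sub.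
exists f; split.
- suff f0 y : f y = 0 -> y = 0.
    move=> y y' yy'; apply/eqP; rewrite -subr_eq0; apply/eqP/f0.
    by rewrite linearB yy' subrr.
  have [c <-] := quotient_proj_surj y.
  rewrite fE => /quotient_proj_eq0/mem_coboundary cB.
  have [Jc dc] := cocycle_val c.
  by apply/quotient_proj_eq0/mem_coboundary; exact: torsion_coboundary_inj cB.
- move=> b; have [c <-] := quotient_proj_surj b.
  have [Lc dc] := cocycle_val c.
  have [v [w [Lv dv Jw dw cE]]] := z_div_cocycle Lc dc.
  have [v' vE] := mk_cocycle Lv dv; have [w' wE] := mk_cocycle Jw dw.
  exists (quotient_proj _ v'), (quotient_proj _ w').
  rewrite fE -linearZ -linearD; congr (quotient_proj _ _).
  by apply: val_inj; apply: val_inj; rewrite /= cE vE wE.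
- move=> b y; have [c <-] := quotient_proj_surj b.
  have [e <-] := quotient_proj_surj y; rewrite fE -linearZ => /eqP.
  rewrite -subr_eq0 -linearB => /eqP/quotient_proj_eq0/mem_coboundary zcB.
  have [Lc dc] := cocycle_val c; have [Je de] := cocycle_val e.
  have zceE : val (val (z *: c - submodule_map incZ e)) =
    z *: val (val c) - val (val e) by [].
  rewrite zceE in zcB; have [w [Jw dw cwB]] := z_inj_cocycle Lc dc Je de zcB.
  have [w' wE] := mk_cocycle Jw dw.
  exists (quotient_proj _ w'); apply/eqP; rewrite -subr_eq0 fE -linearB.
  by apply/eqP/quotient_proj_eq0/mem_coboundary; rewrite /= wE.
Qed.

End Comparison.
End Cohomology.
End Stability.
End Expansion.

(** * Cover ideals *)

Section Polynomials.
Variables (K : fieldType) (n : nat).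
Local Notation R := {mpoly K[n]}.

Lemma mpoly_gen_ind (P : R -> Prop) : (forall c, P c%:MP) -> (forall i, P 'X_i) ->
    (forall p q, P p -> P q -> P (p + q)) ->
    (forall p q, P p -> P q -> P (p * q)) ->
  forall p, P p.
Proof.
move=> PC PX PD PM; elim/mpolyind=> [|c m p _ _ Pp]; first exact: PC 0.
apply: (PD) => //; rewrite -mul_mpolyC; apply: (PM) => //; rewrite mpolyXE_id.
elim/big_ind: _ => [|p1 p2|i _]; [exact: PC 1 | exact: PM |].
elim: (m i) => [|k IHk]; first by rewrite expr0; exact: PC 1.
by rewrite exprS; exact: PM.
Qed.

Definition poly_mpolyC (c : K) : {poly R} := c%:MP%:P.

Let poly_mpolyC_additive : zmod_morphism poly_mpolyC.
Proof. by move=> a b; rewrite /poly_mpolyC !rmorphB. Qed.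

Let poly_mpolyC_multiplicative : monoid_morphism poly_mpolyC.
Proof. by split=> [|a b]; rewrite /poly_mpolyC ?rmorph1 ?rmorphM. Qed.

HB.instance Definition _ := GRing.isZmodMorphism.Build K {poly R} poly_mpolyC
  poly_mpolyC_additive.
HB.instance Definition _ := GRing.isMonoidMorphism.Build K {poly R} poly_mpolyC
  poly_mpolyC_multiplicative.

(* [locked] keeps unification from unfolding [mmap]. *)
Definition expand_var (v : 'I_n) : R -> {poly R} :=
  locked (mmap poly_mpolyC (fun i => if i == v then 'X else ('X_i)%:P)).

Section Expand.
Variable v : 'I_n.

Let expand_var_additive : zmod_morphism (expand_var v).
Proof. by rewrite /expand_var -lock; exact: rmorphB. Qed.

Let expand_var_multiplicative : monoid_morphism (expand_var v).
Proof. by rewrite /expand_var -lock; split; [exact: rmorph1 | exact: rmorphM]. Qed.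

HB.instance Definition _ := GRing.isZmodMorphism.Build R {poly R} (expand_var v)
  expand_var_additive.
HB.instance Definition _ := GRing.isMonoidMorphism.Build R {poly R} (expand_var v)
  expand_var_multiplicative.

Lemma expand_varC c : expand_var v c%:MP = c%:MP%:P.
Proof. by rewrite /expand_var -lock mmapC. Qed.

Lemma expand_varX i : expand_var v 'X_i = if i == v then 'X else ('X_i)%:P.
Proof. by rewrite /expand_var -lock mmapX mmap1U. Qed.

Lemma expand_varD p q :
  expand_var v (p + q) = expand_var v p + expand_var v q.
Proof. exact: rmorphD. Qed.

Lemma expand_varM p q :
  expand_var v (p * q) = expand_var v p * expand_var v q.
Proof. exact: rmorphM. Qed.

Lemma expand_varK p : (expand_var v p).['X_v] = p.
Proof.
elim/mpoly_gen_ind: p => [c|i|p q IHp IHq|p q IHp IHq].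
- by rewrite expand_varC hornerC.
- by rewrite expand_varX; case: eqP => [->|_]; rewrite ?hornerX ?hornerC.
- by rewrite expand_varD hornerD; congr (_ + _); [exact: IHp | exact: IHq].
- by rewrite expand_varM hornerM; congr (_ * _); [exact: IHp | exact: IHq].
Qed.

Lemma expand_var_coef p k :
  expand_var v (expand_var v p)`_k = ((expand_var v p)`_k)%:P.
Proof.
elim/mpoly_gen_ind: p k => [c|i|p q IHp IHq|p q IHp IHq] k.
- by rewrite expand_varC coefC; case: eqP => _; rewrite ?expand_varC ?rmorph0.
- rewrite expand_varX; case: (eqVneq i v) => [_|iv].
    by rewrite coefX; case: eqP => _; rewrite ?rmorph1 ?rmorph0.
  rewrite coefC; case: eqP => _; last by rewrite !rmorph0.
  by rewrite expand_varX (negbTE iv).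
- rewrite expand_varD coefD expand_varD polyCD.
  by congr (_ + _); [exact: IHp | exact: IHq].
- rewrite expand_varM coefM !rmorph_sum; apply: eq_bigr => l _ /=.
  by rewrite expand_varM polyCM; congr (_ * _); [exact: IHp | exact: IHq].
Qed.

Lemma expand_varX_self : expand_var v 'X_v = 'X.
Proof. by rewrite expand_varX eqxx. Qed.

End Expand.

Lemma edge_primeP i j (f : R) :
  f \in edge_prime i j <-> exists a b, f = a * 'X_i + b * 'X_j.
Proof.
split=> [|[a [b ->]]].
  elim/ideal_gen_ind=> [|c g h Sg [a [b ->]]].
    by exists 0, 0; rewrite !mul0r addr0.
  case: Sg => ->; first by exists (c + a), b; rewrite mulrDl addrA.
  by exists a, (c + b); rewrite mulrDl addrCA.
by apply: rpredD; apply: idealMl; apply: mem_ideal_gen; [left | right].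
Qed.

Lemma edge_primeC i j (f : R) : f \in edge_prime i j -> f \in edge_prime j i.
Proof.
by move=> /edge_primeP[a [b ->]]; apply/edge_primeP; exists b, a; rewrite addrC.
Qed.

(** Setting the variable [v] to zero fixes each generator or kills it, so [v] may be [i] or [j]. *)
Lemma edge_prime_coef0 v i j (f : R) :
  f \in edge_prime i j -> (expand_var v f)`_0 \in edge_prime i j.
Proof.
have X0 k : (k == i) || (k == j) -> (expand_var v 'X_k)`_0 \in edge_prime i j.
  move=> kij; rewrite expand_varX; case: eqP => _; first by rewrite coefX rpred0.
  rewrite coefC; apply: mem_ideal_gen.
  by case/orP: kij => /eqP->; [left | right].
move=> /edge_primeP[a [b ->]].
rewrite expand_varD !expand_varM coefD !coef0M.
by apply: rpredD; apply/idealMl/X0; rewrite eqxx ?orbT.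
Qed.

(** Both generators expand to constants, so they factor out of every coefficient. For [v = i] this
    breaks down, as ['X_i] then has the coefficient 1. *)
Lemma edge_prime_coef v i j (f : R) k : i != v -> j != v ->
  f \in edge_prime i j -> (expand_var v f)`_k \in edge_prime i j.
Proof.
move=> /negbTE iv /negbTE jv /edge_primeP[a [b ->]].
rewrite expand_varD !expand_varM !expand_varX iv jv coefD.
rewrite ![_ * _%:P]mulrC !coefCM.
apply/edge_primeP; exists (expand_var v a)`_k, (expand_var v b)`_k.
by congr (_ + _); exact: mulrC.
Qed.

Lemma cover_idealP (G : sgraph n) (f : R) :
  f \in cover_ideal K G <-> forall i j, adj G i j -> f \in edge_prime i j.
Proof.
split=> [/'forall_forallP fJ i j ij|fJ]; first exact: implyP (fJ i j) ij.
by apply/'forall_forallP => i j; apply/implyP; exact: fJ.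
Qed.

(** Equality is proved for each projective resolution separately, so the sets from which the two
    values are picked coincide. [ext_iso] applies because each variable annihilates the residue
    field. *)
Lemma bass_number_iso (A B : lmodType R) (u : {linear A -> B}) (i : 'I_n) p :
    injective u -> (forall b, exists b' x, b = 'X_i *: b' + u x) ->
    (forall b x, 'X_i *: b = u x -> exists y, b = u y) ->
  bass_number A p = bass_number B p.
Proof.
move=> inj_u u_surj u_inj; congr xget; apply/funext => mu; apply/propext.
have XN (y : residue_field K n) : 'X_i *: y = 0.
  have [x <-] := quotient_proj_surj y; rewrite -linearZ.
  apply/quotient_proj_eq0; rewrite /GRing.scale /= mulrC; apply: idealMl.
  by apply: mem_ideal_gen; exists i.
suff FE (F : projective_resolution (residue_field K n)) :
    vdim (Ext F A p) = vdim (Ext F B p).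
  by split=> -[F ->]; exists F; rewrite FE.
have [h h_bij] := ext_iso F XN inj_u u_surj u_inj p.
exact: vdim_bij h_bij.
Qed.

Lemma lyubeznik_number_eq (J L : ideal R) (x z : 'I_n) p i :
    {subset L <= J} ->
    (forall a, a \in J -> forall k, (expand_var x a)`_k \in J) ->
    (forall a, a \in J -> 'X_x * a \in L) ->
    (forall a b, a \in J -> b \in J ->
      exists2 c, c \in L & exists e, a * b = c + e * 'X_z) ->
    (forall a, a \in L -> (expand_var z a)`_0 \in L) ->
  lyubeznik_number L p i = lyubeznik_number J p i.
Proof.
move=> LJ J_coef xJ_L J2_L L_coef0.
congr xget; apply/funext => mu; apply/propext.
suff IE (I : injective_resolution (R^o : lmodType R)) :
    bass_number (local_cohomology J I (n - i)) p =
    bass_number (local_cohomology L I (n - i)) p.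
  by split=> -[I ->]; exists I; rewrite IE.
have z_div j (u : I j) : u \in torsion L (I j) ->
    exists2 v, v \in torsion L (I j) & 'X_z *: v = u.
  apply: (torsion_divisible (@expand_varK z) (@expand_varX_self z) L_coef0).
  exact: ires_injective.
have [f [inj_f f_surj f_inj]] := local_cohomology_comparison
  (@expand_varK x) (@expand_var_coef x) (@expand_varX_self x) J_coef LJ xJ_L
  J2_L z_div (n - i).
exact: bass_number_iso inj_f f_surj f_inj.
Qed.

Lemma msymXi (s : 'S_n) i : msym s 'X_i = 'X_(s i) :> R.
Proof.
rewrite msymX; congr 'X_[_]; apply/mnmP => j; rewrite !mnmE.
by rewrite -(inj_eq (@perm_inj _ s)) permKV.
Qed.

(** * Transport of prime ideals under permutations of the variables *)

Section PrimeChains.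
Variables (s : 'S_n) (P : prime_idealr R).

Definition swap_pred : {pred R} := fun p => msym s p \in P.

Let swap_idealr : idealr_closed swap_pred.
Proof.
split=> [||a u v Pu Pv]; rewrite unfold_in /swap_pred.
- by rewrite rmorph0 idealr0.
- by rewrite rmorph1 idealr1.
- by rewrite rmorphD rmorphM; apply: rpredD => //; exact: idealMr.
Qed.

Let swap_prime : prime_idealr_closed swap_pred.
Proof.
move=> u v uvP; have: msym s (u * v) \in P by [].
by rewrite rmorphM prime_idealrM.
Qed.

HB.instance Definition _ := isIdealr.Build R swap_pred swap_idealr.
HB.instance Definition _ := isPrimeIdealrClosed.Build R swap_pred swap_prime.

Definition swap_ideal : prime_idealr R := swap_pred.

End PrimeChains.
End Polynomials.

Lemma has_prime_chain_sub (R : comNzRingType) (J L : ideal R) d :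
  {subset L <= J} -> has_prime_chain J d -> has_prime_chain L d.
Proof. by move=> LJ [P [JP chainP]]; exists P; split=> // i a /LJ/JP. Qed.

(** * Removal of the leaf [x] attached to [y], where [z] is another neighbour of [y] *)

Section LeafRemoval.
Variables (K : fieldType) (n : nat) (G : sgraph n) (x y z : 'I_n).
Local Notation R := {mpoly K[n]}.
Local Notation J := (cover_ideal K (remove_vertex G x)).
Local Notation L := (cover_ideal K G).
Hypothesis leaf : forall i, adj G x i -> i = y.
Hypothesis xy : adj G x y.
Hypothesis yz : adj G y z.
Hypothesis zx : z != x.

Let yx : y != x. Proof. by apply: contraTneq xy => ->; rewrite adj_irr. Qed.

Lemma mem_cover_ideal_leaf (f : R) :
  f \in L <-> f \in J /\ f \in edge_prime x y.
Proof.
rewrite !cover_idealP; split=> [fL|[fJ fxy] i j ij].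
  by split=> [i j /and3P[ij _ _]|]; exact: fL.
have [ix|ix] := eqVneq i x.
  by move: ij; rewrite ix => /leaf->.
have [jx|jx] := eqVneq j x; last by apply: fJ; rewrite /= ij ix jx.
by move: ij; rewrite jx adj_sym => /leaf->; exact: edge_primeC.
Qed.

Lemma cover_ideal_leaf_yz (f : R) : f \in J -> f \in edge_prime y z.
Proof. by move/cover_idealP; apply; rewrite /= yz yx zx. Qed.

Lemma lyubeznik_number_leaf p i : lyubeznik_number L p i = lyubeznik_number J p i.
Proof.
apply: (@lyubeznik_number_eq K n _ _ x z).
- by move=> a /mem_cover_ideal_leaf[].
- move=> a /cover_idealP Ja k; apply/cover_idealP => u v /and3P[uv ux vx].
  by apply: edge_prime_coef => //; apply: Ja; rewrite /= uv ux vx.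
- move=> a Ja; apply/mem_cover_ideal_leaf; split; first exact: idealMl.
  by apply/edge_primeP; exists a, 0; rewrite mul0r addr0 mulrC.
(* Writing [a = c y + e z], the part [c y b] lies in [J] through [b] and in [(x, y)] through [y];
   the rest is a multiple of [z]. *)
- move=> a b Ja Jb; have /edge_primeP[c [e ->]] := cover_ideal_leaf_yz Ja.
  exists (c * 'X_y * b); last by exists (e * b); rewrite mulrDl mulrAC [e * b * _]mulrAC.
  apply/mem_cover_ideal_leaf; split; first exact: idealMl.
  by apply/edge_primeP; exists 0, (c * b); rewrite mul0r add0r mulrAC.
- move=> a /cover_idealP La; apply/cover_idealP => u v uv.
  by apply: edge_prime_coef0; exact: La.
Qed.

(* A chain above [(x, y)] is carried by the exchange of [x] and [z] to a chain
   above [(y, z)], which contains [J]. *)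
Lemma has_prime_chain_leaf d : has_prime_chain L d <-> has_prime_chain J d.
Proof.
split; last by apply: has_prime_chain_sub => a /mem_cover_ideal_leaf[].
move=> [P [LP chainP]].
have P0_sub i : {subset P ord0 <= P i}.
  have [-> //|i0] := eqVneq i ord0.
  by have [|+ _] := chainP ord0 i; first by rewrite lt0n.
have [JP|/existsNP[a /not_implyP[Ja Pa]]] := pselect {subset J <= P ord0}.
  by exists P; split=> // i a /JP; exact: P0_sub.
(* Here [a] lies in [J] but not in [P ord0]; for [b] in [(x, y)] the product [a b] lies in [L], so
   primality puts [b] into [P ord0]. *)
have Pxy b i : b \in edge_prime x y -> b \in P i.
  move=> xyb; apply: P0_sub; have: a * b \in P ord0.
    apply: LP; apply/mem_cover_ideal_leaf; split; last exact: idealMl.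
    by rewrite mulrC; exact: idealMl.
  by rewrite prime_idealrM => /orP[/Pa|//].
pose s := tperm x z; have sK : involutive (@msym n K s).
  by move=> p; rewrite -msymMm tperm2 msym1m.
exists (fun i => swap_ideal s (P i)); split=> [i f /cover_ideal_leaf_yz|i j ij].
  move=> /edge_primeP[c [e ->]]; rewrite /swap_ideal unfold_in.
  apply: Pxy; apply/edge_primeP; exists (msym s e), (msym s c).
  have zy : z != y by apply: contraTneq yz => ->; rewrite adj_irr.
  have sz : msym s 'X_z = 'X_x :> R by rewrite msymXi tpermR.
  have sy : msym s 'X_y = 'X_y :> R by rewrite msymXi tpermD // eq_sym.
  have -> : msym s (c * 'X_y + e * 'X_z) =
      msym s c * msym s 'X_y + msym s e * msym s 'X_z by rewrite rmorphD !rmorphM.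
  by rewrite sy sz addrC.
have [Pij Pji] := chainP i j ij; split=> [f|Qji]; first exact: Pij.
by apply: Pji => f Pf; rewrite -[f]sK; apply: Qji; rewrite unfold_in sK.
Qed.

Lemma quotient_dim_leaf : quotient_dim L = quotient_dim J.
Proof.
congr xget; apply/funext => d; apply/propext => /=.
by rewrite !has_prime_chain_leaf.
Qed.

Lemma lyubeznik_table_leaf : lyubeznik_table L = lyubeznik_table J.
Proof.
rewrite /lyubeznik_table quotient_dim_leaf; apply: eq_map => i.
by apply: eq_map => p; exact: lyubeznik_number_leaf.
Qed.

End LeafRemoval.

Theorem proposition3p4 (K : fieldType) (n : nat) (G : sgraph n) (xn : 'I_n)
    (last_xn : xn.+1 = n)
    (vertG : vert G = [set: 'I_n]) (connG : sgraph_connected G)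
    (leaf_xn : degree G xn = 1%N)
    (edge_rest : exists i j : 'I_n, adj (remove_vertex G xn) i j) :
  lyubeznik_table (cover_ideal K G) =
    lyubeznik_table (cover_ideal K (remove_vertex G xn)).
Proof.
have /cards1P[y /setP xE] : #|[set u | adj G xn u]| == 1%N by apply/eqP.
have leaf i : adj G xn i = (i == y) by have := xE i; rewrite !inE.
(* Otherwise [xn] and [y] would form a connected component, hence all of [G], and no edge would
   survive the removal of [xn]. *)
have [z yz zx] : exists2 z, adj G y z & z != xn.
  apply: contrapT => noz.
  have yN i : adj G y i -> i = xn.
    by move=> yi; apply/eqP; apply: contra_notT noz => ix; exists i.
  have [i [j /and3P[ij ix jx]]] := edge_rest.
  have closed_xy : fingraph.closed (adj G) [pred u | (u == xn) || (u == y)].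
    apply: intro_closed; first exact/sym_connect_sym/adj_sym.
    move=> u v uv; rewrite !inE => /orP[]/eqP uE; move: uv; rewrite uE.
      by rewrite leaf orbC => ->.
    by move/yN => ->; rewrite eqxx.
  have xy_only u : (u == xn) || (u == y).
    have xu : connect (adj G) xn u by apply: connG; rewrite vertG inE.
    by have /= := closed_connect closed_xy xu; rewrite !inE eqxx.
  have := xy_only i; have := xy_only j.
  rewrite (negbTE ix) (negbTE jx) /= => /eqP jy /eqP iy.
  by move: ij; rewrite iy jy adj_irr.
apply: (lyubeznik_table_leaf K (y := y) (z := z)) => //.
  by move=> i; rewrite leaf => /eqP.
by rewrite leaf.
Qed.
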